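(* Let $\mathcal{H}=\bigotimes_{i=1}^n\mathcal{H}_i$ with $\dim\mathcal{H}_i=d_i$, and set $B:=\sum_{i_1,\dots,i_n=0}^1d_1^{i_1}\cdots d_n^{i_n}$, $C:=\sum_{p|q}(d_p+d_q)$ (sum over non-trivial unordered bipartitions $p|q$ of $\{1,\dots,n\}$, with $d_p=\prod_{i\in p}d_i$), and $D:=d_1\cdots d_n$. The Haar averages of the entangling power $\epsilon_1$ of $n$-partite gates over the unitary group $U(D)$ and over the orthogonal group $O(D)$ (real orthogonal matrices in a fixed product basis) are $$\langle\epsilon_1\rangle_{U(d_1\cdots d_n)}=2\left[1-\left(\prod_{i=1}^n\frac{1}{d_i+1}\right)\frac{BC}{(2^{n-1}-1)(D+1)}\right],$$ $$\langle\epsilon_1\rangle_{O(d_1\cdots d_n)}=2\left[1-\left(\prod_{i=1}^n\frac{1}{d_i+1}\right)\frac{2^n(D+1)-2B+\frac{BD-2^n}{2^{n-1}-1}C}{(D-1)(D+2)}\right].$$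
   Context: For a pure state $|\psi\rangle\in\mathcal{H}$ and a bipartition $p|q$ of $\{1,\dots,n\}$, $\tau_{p|q}(|\psi\rangle)=2\big(1-\operatorname{tr}[(\operatorname{tr}_p|\psi\rangle\langle\psi|)^2]\big)$; the $n$-party one-tangle is $\tau_1=\frac{1}{2^{n-1}-1}\sum_{p|q}\tau_{p|q}$. The entangling power $\epsilon_1(U)$ of a unitary $U$ on $\mathcal{H}$ is the average of $\tau_1(U|\psi_{\rm sep}\rangle)$ over $|\psi_{\rm sep}\rangle=|\psi_1\rangle\otimes\cdots\otimes|\psi_n\rangle$, each $|\psi_i\rangle$ drawn independently from the unitarily invariant measure on pure states of $\mathcal{H}_i$. *)

(* Defs.v *)
From HB Require Import structures.
From mathcomp Require Import all_boot all_order all_algebra.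
From mathcomp Require Import all_classical all_reals all_analysis.
From mathcomp Require Import complex.

Set Implicit Arguments.
Unset Strict Implicit.
Unset Printing Implicit Defensive.

Import Order.TTheory GRing.Theory Num.Theory.
Local Open Scope classical_set_scope.
Local Open Scope ring_scope.

Section Defs.
Variable R : realType.
Local Notation C := (R[i]).

(* product basis index of H: a multi-index (j_1,...,j_n), j_i < d_i *)
Definition idx (n : nat) (d : 'I_n -> nat) : finType :=
  {dffun forall i : 'I_n, 'I_(d i)}.

Definition hvec n (d : 'I_n -> nat) := idx d -> C.
Definition hop n (d : 'I_n -> nat) := idx d -> idx d -> C.

Definition apply_op n (d : 'I_n -> nat) (W : hop d) (psi : hvec d) : hvec d :=
  fun x => \sum_(y : idx d) W x y * psi y.

Definition sep_state n (d : 'I_n -> nat) (psi : forall i : 'I_n, 'I_(d i) -> C)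
  : hvec d := fun x => \prod_(i < n) psi i (x i).

Definition unit_vec (I : finType) (v : I -> C) : Prop :=
  \sum_(j : I) v j * (v j)^* = 1.

Definition unitary (I : finType) (W : I -> I -> C) : Prop :=
  (forall x y, \sum_(z : I) W x z * (W y z)^* = (x == y)%:R) /\
  (forall x y, \sum_(z : I) (W z x)^* * W z y = (x == y)%:R).

Definition orthogonal (I : finType) (W : I -> I -> C) : Prop :=
  (forall x y, complex.Im (W x y) = 0) /\
  (forall x y, \sum_(z : I) W x z * W y z = (x == y)%:R) /\
  (forall x y, \sum_(z : I) W z x * W z y = (x == y)%:R).

Definition mulop (I : finType) (V W : I -> I -> C) : I -> I -> C :=
  fun x y => \sum_(z : I) V x z * W z y.
Definition mulvec (I : finType) (V : I -> I -> C) (v : I -> C) : I -> C :=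
  fun x => \sum_(z : I) V x z * v z.

Definition agree n (d : 'I_n -> nat) (p : {set 'I_n}) (x y : idx d) : bool :=
  [forall i in p, x i == y i].

(* tr[(tr_p |psi><psi|)^2], written out in the product basis:
   with x=(a,b), y=(a,b'), z=(a',b'), w=(a',b)  (a,a' indices on p,
   b,b' indices on q = ~p), this is
   sum_{a,a',b,b'} psi(a b) psi(a b')^* psi(a' b') psi(a' b)^*. *)
Definition purity n (d : 'I_n -> nat) (p : {set 'I_n}) (psi : hvec d) : R :=
  complex.Re (\sum_(x : idx d) \sum_(y : idx d) \sum_(z : idx d) \sum_(w : idx d)
      (if [&& agree p x y, agree p z w, agree (~: p) x w & agree (~: p) y z]
       then psi x * (psi y)^* * psi z * (psi w)^* else 0)).

Definition tau n (d : 'I_n -> nat) (p : {set 'I_n}) (psi : hvec d) : R :=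
  2 * (1 - purity p psi).

(* non-trivial unordered bipartitions p|q of {1..n}; each is represented by
   its block p containing the first party (index 0), q = ~: p. *)
Definition bipartitions n : {set {set 'I_n}} :=
  [set p : {set 'I_n} | [&& p != finset.set0, p != [set: 'I_n]%SET & [exists i in p, val i == 0%N]]].

Definition one_tangle n (d : 'I_n -> nat) (psi : hvec d) : R :=
  (2 ^+ n.-1 - 1)^-1 * \sum_(p in bipartitions n) tau p psi.

(* ---------- measurability on C^I (Borel sigma-algebra via Re/Im coords) --- *)

Definition vec_cyl (I : finType) : set (set (I -> C)) :=
  [set A | exists (j : I) (B : set R), measurable B /\
     (A = [set v | B (complex.Re (v j))] \/ A = [set v | B (complex.Im (v j))])].

Definition op_cyl (I : finType) : set (set (I -> I -> C)) :=
  [set A | exists (j k : I) (B : set R), measurable B /\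
     (A = [set W | B (complex.Re (W j k))] \/ A = [set W | B (complex.Im (W j k))])].

Definition rand_elt (d0 : measure_display) (T : measurableType d0) (V : Type)
  (G : set (set V)) (X : T -> V) : Prop :=
  forall A, <<s G >> A -> measurable (X @^-1` A).

Definition same_law (d0 : measure_display) (T : measurableType d0)
  (P : probability T R) (V : Type) (G : set (set V)) (X Y : T -> V) : Prop :=
  forall A, <<s G >> A -> P (X @^-1` A) = P (Y @^-1` A).

(* psi = (psi_1,...,psi_n) on (Om, P): the psi_i are independent, each psi_i
   is drawn from the unitarily invariant measure on pure states of C^{d i}
   (realised as a U(d_i)-invariant law on unit vectors). *)
Definition random_product_state n (d : 'I_n -> nat)
  (d0 : measure_display) (Om : measurableType d0) (P : probability Om R)
  (psi : Om -> forall i : 'I_n, 'I_(d i) -> C) : Prop :=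
  [/\ forall i, rand_elt (@vec_cyl 'I_(d i)) (fun w => psi w i),
      forall i w, unit_vec (psi w i),
      forall i (V : 'I_(d i) -> 'I_(d i) -> C), unitary V ->
        same_law P (@vec_cyl 'I_(d i))
          (fun w => mulvec V (psi w i)) (fun w => psi w i) &
      forall A : forall i : 'I_n, set ('I_(d i) -> C),
        (forall i, <<s @vec_cyl 'I_(d i) >> (A i)) ->
        P (\bigcap_(i in [set: 'I_n]) ((fun w => psi w i) @^-1` A i)) =
        (\prod_(i < n) P ((fun w => psi w i) @^-1` A i))%E].

Definition entangling_power n (d : 'I_n -> nat)
  (d0 : measure_display) (Om : measurableType d0) (P : probability Om R)
  (psi : Om -> forall i : 'I_n, 'I_(d i) -> C) (W : hop d) : R :=
  Rintegral P setT (fun w => one_tangle (apply_op W (sep_state (psi w)))).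

(* U is Haar distributed on U(D): unitary-valued, law invariant under left
   multiplication by every unitary (Haar measure is unique). *)
Definition haar_unitary (I : finType)
  (d0 : measure_display) (T : measurableType d0) (mu : probability T R)
  (U : T -> I -> I -> C) : Prop :=
  [/\ rand_elt (@op_cyl I) U, forall t, unitary (U t) &
      forall V, unitary V -> same_law mu (@op_cyl I) (fun t => mulop V (U t)) U].

Definition haar_orthogonal (I : finType)
  (d0 : measure_display) (T : measurableType d0) (mu : probability T R)
  (U : T -> I -> I -> C) : Prop :=
  [/\ rand_elt (@op_cyl I) U, forall t, orthogonal (U t) &
      forall V, orthogonal V -> same_law mu (@op_cyl I) (fun t => mulop V (U t)) U].

End Defs.

(* Main.v *)
Require Import Defs.
From HB Require Import structures.
From mathcomp Require Import all_boot all_order all_algebra.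
From mathcomp Require Import perm.
From mathcomp Require Import all_classical all_reals all_analysis.
From mathcomp Require Import measurable_realfun complex.
From mathcomp Require Import zify ring lra.

(** For a fixed gate [W], the mean of [tau_1] over product states is a linear
    function of the fourth-moment tensor
    [M x y z w = E (phi_x phi_y^* phi_z phi_w^* )], [phi = W psi]. Averaging over
    a Haar gate makes [M] invariant under the orthogonal group; sign changes,
    permutations and a single rotation in a coordinate plane force
    [M = a (d_xy d_zw + d_xw d_yz) + b d_xz d_yw], with [b] removable
    in the unitary case. The traces of [M] preserved by the group determine
    the coefficients: [sum M_xxzz = 1], and in the orthogonal case also
    [sum M_xyxy = E |psi^T psi|^2], which by independence is the product of the
    one-party values [2 / (d_i + 1)] given by the unitary case on each factor. *)

Set Implicit Arguments.
Unset Strict Implicit.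
Unset Printing Implicit Defensive.

Import Order.TTheory GRing.Theory Num.Theory.
Import numFieldNormedType.Exports.
Local Open Scope classical_set_scope.
Local Open Scope ring_scope.

(** * Bounded measurable functions *)

(** The laws are given only as equalities of probabilities of events, so every invariance must first
    be carried from events to means; bounded functions and layer cakes do this, and they also yield
    the mean of a product of independent variables. The double average needs no product measure: for
    a fixed gate the state enters through its moment tensor alone, and what remains is a polynomial
    in the entries of the gate. The coefficient [b] belongs to the pairing of the two unconjugated
    indices. A phase [i] on one coordinate reverses its sign, but no real gate excludes it. With
    [D = d_1 ... d_n] and [f] the product of the [1 / (d_i + 1)], the orthogonal coefficients solve
    [a (D^2 + D) + b D = 1] and [2 a D + b D^2 = 2^n f], a system of determinant
    [D^2 (D - 1) (D + 2)]. This is the origin of the denominators and of the condition [1 < D]. The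
    sum [B] is [1 / f], by expanding the product of the [d_i + 1]. *)

Section BoundedMeasurable.
Context (R : realType) (d : measure_display) (T : measurableType d).
Implicit Types (f g : T -> R) (S : set T).

(** The bound is asked only on [S]: coordinates of vectors and operators are measurable everywhere,
    but bounded only on the unit vectors and the unitaries, where the random elements take their
    values. *)
Definition bmeas S f :=
  measurable_fun setT f /\ exists M, forall t, S t -> `|f t| <= M.

Lemma bmeas_cst S c : bmeas S (fun=> c).
Proof. by split; [exact: measurable_cst | exists `|c|]. Qed.

Lemma bmeasD S f g : bmeas S f -> bmeas S g -> bmeas S (fun t => f t + g t).
Proof.
move=> [mf [M fM]] [mg [N gN]]; split; first exact: measurable_funD.
by exists (M + N) => t St; rewrite (le_trans (ler_normD _ _))// lerD ?fM ?gN.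
Qed.

Lemma bmeasM S f g : bmeas S f -> bmeas S g -> bmeas S (fun t => f t * g t).
Proof.
move=> [mf [M fM]] [mg [N gN]]; split; first exact: measurable_funM.
by exists (M * N) => t St; rewrite normrM ler_pM ?fM ?gN.
Qed.

Lemma bmeasN S f : bmeas S f -> bmeas S (fun t => - f t).
Proof.
move=> /(bmeasM (bmeas_cst S (-1))); congr (bmeas S).
by apply/funext => t; rewrite mulN1r.
Qed.

Lemma bmeasB S f g : bmeas S f -> bmeas S g -> bmeas S (fun t => f t - g t).
Proof. by move=> bf /bmeasN; exact: bmeasD. Qed.

Lemma bmeas_sum S (I : Type) (r : seq I) (Q : pred I) (F : I -> T -> R) :
  (forall i, bmeas S (F i)) -> bmeas S (fun t => \sum_(i <- r | Q i) F i t).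
Proof.
move=> bF; elim: r => [|i r IH].
  by under eq_fun do rewrite big_nil; exact: bmeas_cst.
under eq_fun do rewrite big_cons.
by case: (Q i) => //; exact: bmeasD.
Qed.

Lemma bmeas_prod S (I : Type) (r : seq I) (Q : pred I) (F : I -> T -> R) :
  (forall i, bmeas S (F i)) -> bmeas S (fun t => \prod_(i <- r | Q i) F i t).
Proof.
move=> bF; elim: r => [|i r IH].
  by under eq_fun do rewrite big_nil; exact: bmeas_cst.
under eq_fun do rewrite big_cons.
by case: (Q i) => //; exact: bmeasM.
Qed.

Lemma bmeas_indic S (A : set T) : measurable A -> bmeas S (\1_A).
Proof.
move=> mA; split; first exact: measurable_indic.
by exists 1 => t _; rewrite indicE; case: (_ \in _); rewrite ?normr1 ?normr0.
Qed.

Lemma bmeas_integrable (P : probability T R) f :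
  bmeas setT f -> P.-integrable setT (EFin \o f).
Proof.
move=> [mf [M fM]]; apply: measurable_bounded_integrable => //.
  by rewrite (le_lt_trans (probability_le1 P measurableT))// ltry.
by exists M; split; [exact: num_real | move=> x Mx t _; exact: le_trans (fM t _) (ltW Mx)].
Qed.

Lemma Rintegral_prob_cst (P : probability T R) (c : R) : \int[P]_t c = c.
Proof.
rewrite Rintegral_cst//; transitivity (c * fine 1%E); last by rewrite mulr1.
by congr (_ * fine _); exact: probability_setT.
Qed.

Lemma Rintegral_abs_le (P : probability T R) f c :
  bmeas setT f -> (forall t, `|f t| <= c) -> `|\int[P]_t f t| <= c.
Proof.
move=> bf fc; apply: le_trans (le_normr_Rintegral _ _) _ => //.
  exact: bmeas_integrable.
rewrite -[leRHS](Rintegral_prob_cst P).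
apply: le_Rintegral => //; apply: bmeas_integrable; last exact: bmeas_cst.
case: bf => mf [M fM]; split; first exact: measurableT_comp.
by exists M => t _; rewrite normr_id fM.
Qed.

Lemma Rintegral_sum (P : probability T R) (I : Type) (r : seq I) (Q : pred I)
    (F : I -> T -> R) : (forall i, bmeas setT (F i)) ->
  \int[P]_t (\sum_(i <- r | Q i) F i t) = \sum_(i <- r | Q i) \int[P]_t F i t.
Proof.
move=> bF; elim: r => [|i r IH].
  rewrite big_nil; under eq_Rintegral do rewrite big_nil.
  exact: Rintegral_prob_cst.
rewrite big_cons; under eq_Rintegral do rewrite big_cons.
case: (Q i) => //; rewrite RintegralD ?IH//.
- exact: bmeas_integrable.
- by apply: bmeas_integrable; exact: bmeas_sum.
Qed.

Lemma Rintegral_indic (P : probability T R) (A : set T) :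
  measurable A -> \int[P]_t \1_A t = fine (P A).
Proof. by move=> mA; congr fine; rewrite integral_indic// setIT. Qed.

End BoundedMeasurable.

Lemma sum_ltn_nat (m k : nat) : (\sum_(j < m) (j < k)%N = minn m k)%N.
Proof.
elim: m => [|m IH]; first by rewrite big_ord0 min0n.
by rewrite big_ord_recr /= IH; lia.
Qed.

(** The sum counts the integers from 1 to [m] that are at most [m x], so it is the integer part of
    [m x], which is off by less than 1. *)
Lemma step_approx (R : realType) (m : nat) (x : R) : (0 < m)%N -> 0 <= x <= 1 ->
  `|x - m%:R^-1 * \sum_(j < m) ((j.+1%:R / m%:R <= x)%R)%:R| <= m%:R^-1.
Proof.
move=> m0 /andP[x0 x1].
have m0' : 0 < m%:R :> R by rewrite ltr0n.
have y0 : 0 <= m%:R * x by rewrite mulr_ge0// ltW.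
have /andP[kx xk] := truncn_itv y0.
set k := Num.truncn _ in kx xk.
have -> : \sum_(j < m) ((j.+1%:R / m%:R <= x)%R)%:R = k%:R :> R.
  have km : (k <= m)%N.
    by rewrite -(ler_nat R) (le_trans kx)// -[leRHS]mulr1 ler_pM2l.
  transitivity ((minn m k)%:R : R); last by rewrite (minn_idPr km).
  rewrite -sum_ltn_nat natr_sum; apply: eq_bigr => j _; congr (nat_of_bool _)%:R.
  by rewrite ler_pdivrMr// mulrC /k truncn_gt_nat.
have -> : x - m%:R^-1 * k%:R = m%:R^-1 * (m%:R * x - k%:R).
  by rewrite mulrBr mulKf// gt_eqF.
rewrite normrM gtr0_norm ?invr_gt0// ger_pMr ?invr_gt0//.
rewrite ger0_norm ?subr_ge0// lerBlDl; apply: ltW.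
by rewrite -[_ + 1]/(k%:R + 1%:R) -natrD addn1.
Qed.

(* Layer cake: X is within 1/m of the average of the indicators of [X >= j/m]. *)
Lemma eq_Rintegral_layer (R : realType)
    (d : measure_display) (T : measurableType d) (P : probability T R)
    (d' : measure_display) (T' : measurableType d') (P' : probability T' R)
    (Z X : T -> R) (Z' X' : T' -> R) :
  bmeas setT Z -> bmeas setT X -> bmeas setT Z' -> bmeas setT X' ->
  (forall t, `|Z t| <= 1) -> (forall t, 0 <= X t <= 1) ->
  (forall t, `|Z' t| <= 1) -> (forall t, 0 <= X' t <= 1) ->
  (forall r, \int[P]_t (Z t * \1_[set t | r <= X t] t) =
             \int[P']_t (Z' t * \1_[set t | r <= X' t] t)) ->
  \int[P]_t (Z t * X t) = \int[P']_t (Z' t * X' t).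
Proof.
pose S d (T : measurableType d) (Z X : T -> R) m t :=
  m%:R^-1 * \sum_(j < m) (Z t * \1_[set t | j.+1%:R / m%:R <= X t] t).
have mX d1 (T1 : measurableType d1) (X1 : T1 -> R) r : bmeas setT X1 ->
    measurable [set t | r <= X1 t].
  by move=> [mX _]; rewrite -[X in measurable X]setTI; apply: measurable_fun_le.
have bZ1 d1 (T1 : measurableType d1) (Z1 X1 : T1 -> R) r : bmeas setT Z1 ->
    bmeas setT X1 -> bmeas setT (fun t => Z1 t * \1_[set t | r <= X1 t] t).
  by move=> bZ bX; apply: bmeasM => //; apply: bmeas_indic; exact: mX.
have bS d1 (T1 : measurableType d1) (Z1 X1 : T1 -> R) m : bmeas setT Z1 ->
    bmeas setT X1 -> bmeas setT (S _ _ Z1 X1 m).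
  move=> bZ bX; apply: bmeasM; first exact: bmeas_cst.
  by apply: bmeas_sum => j; exact: bZ1.
have approx d1 (T1 : measurableType d1) (P1 : probability T1 R)
    (Z1 X1 : T1 -> R) m : bmeas setT Z1 -> bmeas setT X1 ->
    (forall t, `|Z1 t| <= 1) -> (forall t, 0 <= X1 t <= 1) ->
    `|\int[P1]_t (Z1 t * X1 t) - m.+1%:R^-1 *
      \sum_(j < m.+1) \int[P1]_t (Z1 t * \1_[set t | j.+1%:R / m.+1%:R <= X1 t] t)|
      <= m.+1%:R^-1.
  move=> bZ bX Z_1 X01.
  rewrite -Rintegral_sum; last by move=> i; exact: bZ1.
  rewrite -RintegralZl//; last first.
    by apply: bmeas_integrable; apply: bmeas_sum => j; exact: bZ1.
  rewrite -RintegralB//; last 2 first.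
  - by apply: bmeas_integrable; exact: bmeasM.
  - by apply: bmeas_integrable; exact: bS.
  apply: Rintegral_abs_le.
    by apply: bmeasB; [exact: bmeasM | exact: bS].
  (* The weight factors out of the pointwise error and, being at most 1 in modulus, does not enlarge
     it. *)
  move=> t; rewrite -mulr_sumr mulrCA -mulrBr normrM.
  rewrite -[leRHS]mul1r ler_pM//.
  rewrite (eq_bigr (fun j : 'I_m.+1 => ((j.+1%:R / m.+1%:R <= X1 t)%R)%:R)).
    exact: step_approx.
  by move=> j _; rewrite indicE; congr (nat_of_bool _)%:R; apply/idP/idP; rewrite inE.
move=> bZ bX bZ' bX' Z1 X1 Z1' X1' E.
apply/eqP; rewrite -subr_eq0 -normr_le0; apply/ler_addgt0Pl => e e0; rewrite addr0.
have [m me] : exists m : nat, m.+1%:R^-1 <= e / 2.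
  exists (Num.truncn (e / 2)^-1).
  rewrite invf_ple ?posrE ?divr_gt0// ltW//.
  exact: truncnS_gt.
have A1 := approx _ _ P _ _ m bZ bX Z1 X1.
have A2 := approx _ _ P' _ _ m bZ' bX' Z1' X1'.
move: A1; rewrite (eq_bigr (fun j : 'I_m.+1 =>
  \int[P']_t (Z' t * \1_[set t | j.+1%:R / m.+1%:R <= X' t] t)))// => A1.
have := le_trans (ler_normB _ _) (lerD A1 A2).
rewrite opprB addrA subrK => /le_trans; apply.
by rewrite [leRHS]splitr lerD.
Qed.

(** * Complex means *)

Section ComplexMean.
Context (R : realType) (d : measure_display) (T : measurableType d).
Context (P : probability T R).
Implicit Types (f g : T -> R[i]) (S : set T).

Definition cbmeas S f :=
  bmeas S (fun t => complex.Re (f t)) /\ bmeas S (fun t => complex.Im (f t)).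

Definition cmean f : R[i] :=
  Complex (\int[P]_t complex.Re (f t)) (\int[P]_t complex.Im (f t)).

Lemma cbmeas_cst S c : cbmeas S (fun=> c).
Proof. by split; exact: bmeas_cst. Qed.

Lemma ReD (x y : R[i]) : complex.Re (x + y) = complex.Re x + complex.Re y.
Proof. by case: x; case: y. Qed.
Lemma ImD (x y : R[i]) : complex.Im (x + y) = complex.Im x + complex.Im y.
Proof. by case: x; case: y. Qed.
Lemma ReM (x y : R[i]) : complex.Re (x * y) =
  complex.Re x * complex.Re y - complex.Im x * complex.Im y.
Proof. by case: x; case: y. Qed.
Lemma ImM (x y : R[i]) : complex.Im (x * y) =
  complex.Re x * complex.Im y + complex.Im x * complex.Re y.
Proof. by case: x; case: y. Qed.
Lemma ReC (x : R[i]) : complex.Re x^* = complex.Re x.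
Proof. by case: x. Qed.
Lemma ImC (x : R[i]) : complex.Im x^* = - complex.Im x.
Proof. by case: x. Qed.

Lemma cbmeasD S f g : cbmeas S f -> cbmeas S g -> cbmeas S (fun t => f t + g t).
Proof.
by move=> [f1 f2] [g1 g2]; split; [under eq_fun do rewrite ReD|
  under eq_fun do rewrite ImD]; exact: bmeasD.
Qed.

Lemma cbmeasM S f g : cbmeas S f -> cbmeas S g -> cbmeas S (fun t => f t * g t).
Proof.
move=> [f1 f2] [g1 g2]; split.
  by under eq_fun do rewrite ReM; apply: bmeasB; exact: bmeasM.
by under eq_fun do rewrite ImM; apply: bmeasD; exact: bmeasM.
Qed.

Lemma cbmeasC S f : cbmeas S f -> cbmeas S (fun t => (f t)^*).
Proof.
move=> [f1 f2]; split; first by under eq_fun do rewrite ReC.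
by under eq_fun do rewrite ImC; exact: bmeasN.
Qed.

Lemma cbmeas_sum S (I : Type) (r : seq I) (Q : pred I) (F : I -> T -> R[i]) :
  (forall i, cbmeas S (F i)) -> cbmeas S (fun t => \sum_(i <- r | Q i) F i t).
Proof.
move=> bF; elim: r => [|i r IH].
  by under eq_fun do rewrite big_nil; exact: cbmeas_cst.
under eq_fun do rewrite big_cons.
by case: (Q i) => //; exact: cbmeasD.
Qed.

Lemma cbmeas_prod S (I : Type) (r : seq I) (Q : pred I) (F : I -> T -> R[i]) :
  (forall i, cbmeas S (F i)) -> cbmeas S (fun t => \prod_(i <- r | Q i) F i t).
Proof.
move=> bF; elim: r => [|i r IH].
  by under eq_fun do rewrite big_nil; exact: cbmeas_cst.
under eq_fun do rewrite big_cons.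
by case: (Q i) => //; exact: cbmeasM.
Qed.

Lemma cmean_cst c : cmean (fun=> c) = c.
Proof. by case: c => a b; rewrite /cmean !Rintegral_prob_cst. Qed.

Lemma eq_cmean f g : f =1 g -> cmean f = cmean g.
Proof. by move=> /funext ->. Qed.

Lemma cmeanD f g : cbmeas setT f -> cbmeas setT g ->
  cmean (fun t => f t + g t) = cmean f + cmean g.
Proof.
move=> [f1 f2] [g1 g2]; apply/eqP; rewrite eq_complex/=; apply/andP; split; apply/eqP.
  by under eq_Rintegral do rewrite ReD; apply: RintegralD => //; exact: bmeas_integrable.
by under eq_Rintegral do rewrite ImD; apply: RintegralD => //; exact: bmeas_integrable.
Qed.

Lemma cmeanZ c f : cbmeas setT f -> cmean (fun t => c * f t) = c * cmean f.
Proof.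
move=> [f1 f2]; apply/eqP; rewrite eq_complex/= ReM ImM /=.
under eq_Rintegral do rewrite ReM; under [X in _ && (X == _)]eq_Rintegral do rewrite ImM.
rewrite RintegralB ?RintegralD ?RintegralZl ?eqxx//;
  apply: bmeas_integrable => //; exact: bmeasM (bmeas_cst _ _) _.
Qed.

Lemma cmean_sum (I : Type) (r : seq I) (Q : pred I) (F : I -> T -> R[i]) :
  (forall i, cbmeas setT (F i)) ->
  cmean (fun t => \sum_(i <- r | Q i) F i t) = \sum_(i <- r | Q i) cmean (F i).
Proof.
move=> bF; elim: r => [|i r IH].
  by rewrite big_nil -[RHS]cmean_cst; apply: eq_cmean => t; rewrite big_nil.
rewrite big_cons; under eq_cmean do rewrite big_cons.
by case: (Q i) => //; rewrite cmeanD ?IH//; exact: cbmeas_sum.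
Qed.

Lemma cmean_sum2 (I J : finType) (F : I -> J -> T -> R[i]) :
  (forall i j, cbmeas setT (F i j)) ->
  cmean (fun t => \sum_i \sum_j F i j t) = \sum_i \sum_j cmean (F i j).
Proof.
move=> bF; rewrite cmean_sum; last by move=> i; exact: cbmeas_sum.
by apply: eq_bigr => i _; exact: cmean_sum.
Qed.

End ComplexMean.

(** * Transfer of equality in law to means *)

Section SameLaw.
Context (R : realType).
(** [g_sigma_algebraType] is used over a pointed type; a point of [R[i]] makes the spaces of vectors
    and of operators pointed. *)
HB.instance Definition _ := isPointed.Build R[i] 0.

Context (V : pointedType) (G : set (set V)).
Local Notation VG := (g_sigma_algebraType G).
Context (S : set VG).
Context (d : measure_display) (T : measurableType d) (P : probability T R).

Lemma bmeas_comp (X : T -> V) (g : VG -> R) :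
  rand_elt G X -> (forall t, S (X t)) -> bmeas S g ->
  bmeas setT (fun t => g (X t)).
Proof.
move=> mX XS [mg [M gM]]; split; last by exists M => t _; exact: gM.
apply: (measurable_comp measurableT _ mg) => //.
by move=> _ A mA; rewrite setTI; exact: mX.
Qed.

Lemma cbmeas_comp (X : T -> V) (g : VG -> R[i]) :
  rand_elt G X -> (forall t, S (X t)) -> cbmeas S g ->
  cbmeas setT (fun t => g (X t)).
Proof.
by move=> mX XS [bRe bIm]; split;
  [exact: (bmeas_comp mX XS bRe) | exact: (bmeas_comp mX XS bIm)].
Qed.

(* A bounded function is rescaled to take values in [0, 1], where its mean is
   determined by the probabilities of its superlevel sets. *)
Lemma same_law_Rintegral (X Y : T -> V) (g : VG -> R) :
  same_law P G X Y -> (forall t, S (X t)) -> (forall t, S (Y t)) ->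
  measurable_fun setT (fun t => g (X t)) -> rand_elt G Y -> bmeas S g ->
  \int[P]_t g (X t) = \int[P]_t g (Y t).
Proof.
move=> XY SX SY mX rY bg; have bY := bmeas_comp rY SY bg.
have bX : bmeas setT (fun t => g (X t)).
  by split=> //; have [_ [M gM]] := bg; exists M => t _; exact: gM.
have [mg [M0 gM0]] := bg; pose M := `|M0| + 1.
have M_gt0 : 0 < M by rewrite ltr_pwDr.
have gM v : S v -> `|g v| <= M.
  by move=> /gM0 /le_trans; apply; rewrite (le_trans (ler_norm _))// lerDl.
(* The affine map from [[-M, M]] onto [[0, 1]]; the 1 added in [M] keeps the divisor nonzero. *)
pose h (f : T -> R) t := (f t + M) * (2 * M)^-1.
have bh f : bmeas setT f -> bmeas setT (h f).
  by move=> bf; apply: bmeasM; [apply: bmeasD => //|]; exact: bmeas_cst.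
have h01 f : (forall t, `|f t| <= M) -> forall t, 0 <= h f t <= 1.
  move=> f1 t; have := f1 t; rewrite ler_norml => /andP[f1' f2'].
  have M2 : 0 < 2 * M by rewrite mulr_gt0.
  by apply/andP; split; [rewrite /h divr_ge0 ?(ltW M2)//|rewrite /h ler_pdivrMr//]; lra.
have inth f : bmeas setT f ->
    \int[P]_t f t = 2 * M * \int[P]_t (1 * h f t) - M.
  move=> bf; under [in RHS]eq_Rintegral do rewrite mul1r.
  rewrite -[in RHS]RintegralZl//; last exact/bmeas_integrable/bh.
  rewrite -[X in _ - X](Rintegral_prob_cst P) -RintegralB//; last 2 first.
  - by apply: bmeas_integrable; apply: bmeasM; [exact: bmeas_cst|exact: bh].
  - by apply: bmeas_integrable; exact: bmeas_cst.
  by apply: eq_Rintegral => t _; rewrite /h mulrC divfK ?addrK// gt_eqF// mulr_gt0.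
rewrite (inth _ bX) (inth _ bY); congr (_ * _ - _).
apply: eq_Rintegral_layer; do ?[exact: bmeas_cst | exact: bh
  | by move=> t; rewrite normr1 | by apply: h01 => t; exact: gM].
move=> r; under eq_Rintegral do rewrite mul1r.
under [RHS]eq_Rintegral do rewrite mul1r.
have E (Z : T -> V) : [set t | r <= h (fun t => g (Z t)) t] =
    Z @^-1` (g @^-1` [set` `[r * (2 * M) - M, +oo[]).
  apply/seteqP; split => t;
    by rewrite /= in_itv/= andbT /h ler_pdivlMr ?mulr_gt0// lerBlDr.
have mA : <<s G >> (g @^-1` [set` `[r * (2 * M) - M, +oo[]).
  by rewrite -[X in <<s _ >> X]setTI; apply: mg => //; exact: measurable_itv.
rewrite !E !Rintegral_indic; first by rewrite XY.
- exact: rY.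
- by rewrite -[X in measurable X]setTI; apply: mX => //; exact: measurable_itv.
Qed.

(** Measurability is asked of [g] composed with [X], not of [X]: in the applications [X] is a
    rotated vector or gate, and [g] of it is visibly a polynomial in measurable coordinates. *)
Lemma same_law_cmean (X Y : T -> V) (g : VG -> R[i]) :
  same_law P G X Y -> (forall t, S (X t)) -> (forall t, S (Y t)) ->
  cbmeas setT (fun t => g (X t)) -> rand_elt G Y -> cbmeas S g ->
  cmean P (fun t => g (X t)) = cmean P (fun t => g (Y t)).
Proof.
move=> XY SX SY [[mX1 _] [mX2 _]] rY [bRe bIm].
by congr Complex; [exact: (same_law_Rintegral XY SX SY mX1 rY bRe)
                 | exact: (same_law_Rintegral XY SX SY mX2 rY bIm)].
Qed.

End SameLaw.

(** * Invariant fourth-order tensors *)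

Section Tensor.
Context (R : realType) (I : finType).
Local Notation C := R[i].
Local Notation "x %:RC" := (real_complex R x) (at level 1, format "x %:RC").
Implicit Types (V W : I -> I -> C) (M N : I -> I -> I -> I -> C).

(* The action of V (x) V^* (x) V (x) V^*. *)
Definition act4 V M x y z w : C :=
  \sum_x' V x x' * (\sum_y' (V y y')^* * (\sum_z' V z z' *
    (\sum_w' (V w w')^* * M x' y' z' w'))).

Lemma conj_real (x : R) : (x%:RC)^* = x%:RC.
Proof. exact: conjc_real. Qed.

Lemma sum_delta (b : I) (F : I -> C) : \sum_y (b == y)%:R * F y = F b.
Proof.
rewrite (bigD1 b)//= eqxx mul1r big1 ?addr0// => y /negPf.
by rewrite eq_sym => ->; rewrite mul0r.
Qed.

Lemma sum_delta2 (a b : I) : \sum_z (a == z)%:R * (b == z)%:R = (a == b)%:R :> C.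
Proof. by rewrite sum_delta eq_sym. Qed.

Lemma act4_monomial (e : I -> C) (s : I -> I) M x y z w :
  act4 (fun u v => e u * (s u == v)%:R) M x y z w =
  e x * (e y)^* * e z * (e w)^* * M (s x) (s y) (s z) (s w).
Proof.
have E u F : \sum_v (e u * (s u == v)%:R) * F v = e u * F (s u).
  by under eq_bigr do rewrite -mulrA; rewrite -mulr_sumr sum_delta.
have E' u F : \sum_v (e u * (s u == v)%:R)^* * F v = (e u)^* * F (s u).
  under eq_bigr do rewrite rmorphM/= conjC_nat -mulrA.
  by rewrite -mulr_sumr sum_delta.
by rewrite /act4 E E' E E' !mulrA.
Qed.

Lemma orthogonal_unitary V : Defs.orthogonal V -> unitary V.
Proof.
move=> [imV [row col]]; have rV x y : (V x y)^* = V x y.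
  by have := imV x y; case: (V x y) => a b /= ->; congr Complex; rewrite oppr0.
split=> x y; [rewrite -row | rewrite -col]; apply: eq_bigr => z _.
all: by rewrite rV.
Qed.

(** For an involution [t], with [c] even and [s] odd under it, this rotates each plane spanned by
    [u] and [t u]; at a fixed point of [t] oddness forces [s u = 0], and the diagonal entry is
    [c u]. *)
Definition mixing (c s : I -> R) (t : I -> I) (u v : I) : C :=
  (c u)%:RC * (u == v)%:R + (s u)%:RC * (t u == v)%:R.

Lemma mixing_orthogonal (c s : I -> R) (t : I -> I) :
  involutive t -> (forall u, c (t u) = c u) -> (forall u, s (t u) = - s u) ->
  (forall u, c u ^+ 2 + s u ^+ 2 = 1) -> Defs.orthogonal (mixing c s t).
Proof.
move=> tK ct.
(* Stated for any odd [r], because the transpose is the same matrix with [- s]: the orthonormality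
   of the columns is then a second instance. *)
have row (r : I -> R) x y : (forall u, r (t u) = - r u) ->
    (forall u, c u ^+ 2 + r u ^+ 2 = 1) ->
    \sum_z mixing c r t x z * mixing c r t y z = (x == y)%:R.
  move=> rt cr1.
  transitivity ((c x * c y + r x * r y)%:RC * (x == y)%:R
                + (c x * r y + r x * c y)%:RC * (t x == y)%:R).
    under eq_bigr => z _ do (rewrite /mixing mulrDl !mulrDr).
    rewrite !big_split/=.
    have E (k l : C) (a b : I) : \sum_z k * (a == z)%:R * (l * (b == z)%:R) =
        k * l * (a == b)%:R.
      rewrite -(sum_delta2 a b) mulr_sumr; apply: eq_bigr => z _.
      by rewrite mulrACA.
    rewrite !E !rmorphD !rmorphM/= (can_eq tK) (_ : (x == t y) = (t x == y)).
      by ring.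
    by rewrite -(can_eq tK) tK.
  have [<-|xy] := eqVneq x y.
    rewrite -!expr2 cr1 rmorph1 mul1r.
    have [tx|] := eqVneq (t x) x; last by rewrite mulr0 addr0.
    have rx : r x = 0 by have := rt x; rewrite tx; lra.
    by rewrite rx mulr0 mul0r addr0 rmorph0 mul0r addr0.
  rewrite mulr0 add0r; have [<-|] := eqVneq (t x) y; last by rewrite mulr0.
  by rewrite ct rt mulrN (mulrC (r x)) addNr rmorph0 mul0r.
move=> st cs1; split; [|split].
- move=> x y; rewrite /mixing; case: (x == y); case: (t x == y);
    by rewrite /= ?mulr0 ?mulr1 ?addr0 ?add0r//= ?addr0.
- by move=> x y; exact: row.
have tr x y : mixing c s t y x = mixing c (\- s) t x y.
  rewrite /mixing /= [y == x]eq_sym (_ : (t y == x) = (t x == y)); last first.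
    by rewrite -(can_eq tK) tK eq_sym.
  have [->|_] := eqVneq x y; last first.
    have [<-|_] := eqVneq (t x) y; last by rewrite !mulr0.
    by rewrite !mulr0 st.
  have [ty|_] := eqVneq (t y) y; last by rewrite !mulr0.
  have sy : s y = 0 by have := st y; rewrite ty; lra.
  by rewrite sy oppr0.
move=> x y; under eq_bigr do rewrite !tr.
apply: row => [u|u] /=; first by rewrite st.
by rewrite sqrrN.
Qed.

Lemma signed_perm_orthogonal (e : I -> R) (s : I -> I) : injective s ->
  (forall u, e u ^+ 2 = 1) ->
  Defs.orthogonal (fun u v => (e u)%:RC * (s u == v)%:R).
Proof.
move=> si e1; split; [|split].
- by move=> x y; case: (s x == y); rewrite ?mulr1 ?mulr0.
- move=> x y; under eq_bigr do rewrite mulrACA.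
  rewrite -mulr_sumr sum_delta2 (inj_eq si).
  by have [->|_] := eqVneq x y; rewrite ?mulr0// mulr1 -rmorphM -expr2 e1.
- move=> x y; under eq_bigr => z _ do
    rewrite mulrACA -rmorphM -expr2 e1 mul1r ![s z == _]eq_sym.
  by rewrite -(sum_delta2 x y) [RHS](reindex_inj si).
Qed.

(** The first two pairings join an unconjugated index to a conjugated one, and share a coefficient
    because exchanging [x] and [z] swaps them. The third joins like to like and is preserved by real
    matrices only. *)
Definition wick (a b : C) (x y z w : I) : C :=
  a * ((x == y)%:R * (z == w)%:R + (x == w)%:R * (y == z)%:R)
  + b * ((x == z)%:R * (y == w)%:R).

Section Invariant.
Variable M : I -> I -> I -> I -> C.
Hypothesis M_sym : forall x y z w, M x y z w = M z y x w.
Hypothesis M_inv : forall V, Defs.orthogonal V ->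
  forall x y z w, act4 V M x y z w = M x y z w.

(** Reflecting the coordinate [k] multiplies the entry by -1 once for each occurrence of [k]. *)
Lemma inv_sign k x y z w :
  odd ((x == k) + (y == k) + (z == k) + (w == k)) -> M x y z w = 0.
Proof.
pose e u : R := if u == k then -1 else 1.
have e1 u : e u ^+ 2 = 1 by rewrite /e; case: ifP; rewrite ?sqrrN expr1n.
have := M_inv (@signed_perm_orthogonal e id (@inj_id _) e1) x y z w.
rewrite act4_monomial /= !conj_real /e => E od.
have : M x y z w = - M x y z w.
  rewrite -[LHS]E; move: od; do 4 case: (_ == k); move=> // _;
    by rewrite ?rmorphN !rmorph1; ring.
move/eqP; rewrite -subr_eq0 opprK -mulr2n mulrn_eq0/= => /eqP//.
Qed.

(** By permutation matrices, an entry depends only on which of its indices coincide. *)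
Lemma inv_perm (s : I -> I) x y z w : injective s ->
  M (s x) (s y) (s z) (s w) = M x y z w.
Proof.
move=> si; have e1 (u : I) : (1 : R) ^+ 2 = 1 by rewrite expr1n.
have := M_inv (@signed_perm_orthogonal (fun=> 1) s si e1) x y z w.
by rewrite act4_monomial /= !conj_real !rmorph1 !mul1r.
Qed.

Lemma two_point_perm (x z x' z' : I) : x != z -> x' != z' ->
  exists s : I -> I, [/\ injective s, s x = x' & s z = z'].
Proof.
(* The first transposition takes [x] to [x']; the second takes the new position of [z] to [z'] and
   fixes [x'], which differs from both. *)
move=> xz xz'; exists (tperm (tperm x x' z) z' \o tperm x x').
split; first by apply: inj_comp; exact: perm_inj.
- rewrite /= tpermL tpermD//; last by rewrite eq_sym.
  by rewrite -{2}(tpermL x x') (inj_eq perm_inj) eq_sym.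
- by rewrite /= tpermL.
Qed.

(** A rotation by an angle with cosine [c] and sine [s] in the plane of [x] and [y] expands
    [M x x x x] into sixteen terms. Parity removes eight, and the rest give [(c^4 + s^4) M x x x x +
    c^2 s^2 (4 M x x y y + 2 M x y x y)]. *)
Lemma inv_fourth x y : x != y ->
  M x x x x = M x x y y *+ 2 + M x y x y.
Proof.
(* The Pythagorean pair 3/5, 4/5 keeps the rotation rational; any angle with both [c] and [s]
   nonzero would serve. *)
move=> xy; pose c u : R := if (u == x) || (u == y) then 3 / 5 else 1.
pose s u : R := if u == x then 4 / 5 else if u == y then - (4 / 5) else 0.
have yx : y == x = false by rewrite eq_sym (negPf xy).
have tx u : (tperm x y u == x) = (u == y).
  by rewrite -(can_eq (tpermK x y)) tpermK tpermL.
have ty u : (tperm x y u == y) = (u == x).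
  by rewrite -(can_eq (tpermK x y)) tpermK tpermR.
have oV : Defs.orthogonal (mixing c s (tperm x y)).
  apply: mixing_orthogonal; first exact: tpermK.
  - by move=> u; rewrite /c tx ty orbC.
  - move=> u; rewrite /s tx ty; have [->|_] := eqVneq u y; rewrite ?yx ?opprK//.
    by case: ifP; rewrite // oppr0.
  - move=> u; rewrite /c /s; have [->|_] := eqVneq u x => /=.
      by lra.
    by case: eqVneq => _ /=; lra.
have E F : \sum_v mixing c s (tperm x y) x v * F v = 3 / 5 * F x + 4 / 5 * F y.
  under eq_bigr do rewrite mulrDl -!mulrA.
  rewrite big_split/= -!mulr_sumr !sum_delta tpermL /c /s eqxx/=.
  by rewrite !fmorph_div/= !rmorph_nat.
have E' F : \sum_v (mixing c s (tperm x y) x v)^* * F v = 3 / 5 * F x + 4 / 5 * F y.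
  rewrite -E; apply: eq_bigr => v _; congr (_ * _).
  by rewrite rmorphD !rmorphM/= !conjC_nat !conj_real.
have := M_inv oV x x x x; rewrite /act4 E !E' !E !E'.
have zr a b c' d : odd ((a == x) + (b == x) + (c' == x) + (d == x)) ->
  M a b c' d = 0 by exact: inv_sign.
rewrite !(zr x x x y) ?(zr x x y x) ?(zr x y x x) ?(zr y x x x) ?(zr y y y x)
  ?(zr y y x y) ?(zr y x y y) ?(zr x y y y) ?eqxx ?yx//.
have sw a b c' d := @inv_perm (tperm x y) a b c' d perm_inj.
have := sw x x x x; have := sw x x y y; have := sw x y x y.
rewrite !tpermL !tpermR (M_sym x y y x) (M_sym y x x y) => -> -> ->.
(* [288 / 625] is [1 - c^4 - s^4 = 2 c^2 s^2]. *)
move=> E4; apply: (mulfI (_ : 288 / 625 != 0 :> C)).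
  by rewrite mulf_neq0 ?invr_neq0 ?pnatr_eq0.
move/eqP: E4; rewrite -subr_eq0 => /eqP E4; apply/eqP; rewrite -subr_eq0.
by rewrite -oppr_eq0; apply/eqP; rewrite -[RHS]E4; field.
Qed.

Lemma inv_wick : exists a b, forall x y z w, M x y z w = wick a b x y z w.
Proof.
have [[x0 x1]/= x01|noneq] := pickP (fun p : I * I => p.1 != p.2); last first.
  have eqI (x y : I) : x = y by apply/eqP; have := noneq (x, y); case: eqP.
  have [x0 _|I0] := pickP (@predT I); last by exists 0, 0 => x; have := I0 x.
  (* On a single index the three pairings are all 1, so the coefficients are not unique and [a = 0]
     is a choice. *)
  exists 0, (M x0 x0 x0 x0) => x y z w.
  rewrite (eqI x x0) (eqI y x0) (eqI z x0) (eqI w x0) /wick eqxx.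
  by rewrite mul0r add0r !mulr1.
exists (M x0 x0 x1 x1), (M x0 x1 x0 x1).
have pairs x z : x != z -> M x x z z = M x0 x0 x1 x1 /\ M x z x z = M x0 x1 x0 x1.
  move=> xz; have [s [si <- <-]] := two_point_perm x01 xz.
  by rewrite !inv_perm.
(* A pattern in which some value occurs an odd number of times vanishes by [inv_sign]. The three
   pairings of distinct values are [pairs], up to [M_sym]; four equal indices reduce to them by
   [inv_fourth], a second value existing because [x0 != x1]. *)
move=> x y z w; rewrite /wick.
have [<-|xy] := eqVneq x y.
  have [<-|zw] := eqVneq z w.
    have [<-|xz] := eqVneq x z; last first.
      by rewrite (pairs _ _ xz).1 !mulr0 addr0 addr0 !mulr1.
    have [y' y'x|eqx] := pickP (fun y' => y' != x); last first.
      have eqI u : u = x by apply/eqP/negbFE/eqx.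
      by rewrite (eqI x0) (eqI x1) eqxx in x01.
    have xy' : x != y' by rewrite eq_sym.
    by rewrite (inv_fourth xy') (pairs _ _ xy').1 (pairs _ _ xy').2 /=; ring.
  rewrite (@inv_sign w); last first.
    by rewrite eqxx (negPf zw); case: (x == w).
  have xwz : (x == w)%:R * (x == z)%:R = 0 :> C.
    have [xw|_] := eqVneq x w; last by rewrite mul0r.
    by rewrite xw eq_sym (negPf zw) mulr0.
  by rewrite [(x == z)%:R * _]mulrC xwz /=; ring.
have yx : y == x = false by rewrite eq_sym (negPf xy).
have [<-|xw] := eqVneq x w.
  have [<-|yz] := eqVneq y z.
    rewrite M_sym (pairs _ _ (negbT yx)).1 (negPf xy).
    by rewrite /=; ring.
  rewrite (@inv_sign y); last by rewrite eqxx (negPf xy) eq_sym (negPf yz).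
  by rewrite yx /=; ring.
have [<-|xz] := eqVneq x z.
  have [<-|yw] := eqVneq y w; first by rewrite (pairs _ _ xy).2 /=; ring.
  rewrite (@inv_sign y); first by rewrite /=; ring.
  by rewrite eqxx (negPf xy) eq_sym (negPf yw).
rewrite (@inv_sign x); first by rewrite /=; ring.
by rewrite eqxx yx ![_ == x]eq_sym (negPf xz) (negPf xw).
Qed.

End Invariant.
End Tensor.

(** * The unitary case, and the traces preserved by the gates *)

Section TensorTraces.
Context (R : realType) (I : finType).
Local Notation C := R[i].
Implicit Types (V W : I -> I -> C) (M N : I -> I -> I -> I -> C).

Lemma inv_wick_unitary M :
  (forall x y z w, M x y z w = M z y x w) ->
  (forall V, unitary V -> forall x y z w, act4 V M x y z w = M x y z w) ->
  exists a, forall x y z w, M x y z w = wick a 0 x y z w.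
Proof.
move=> Msym Minv; have [|a [b Mab]] := @inv_wick R I M Msym.
  by move=> V oV; apply: Minv; exact: orthogonal_unitary.
have [[x y]/= xy|noneq] := pickP (fun p : I * I => p.1 != p.2); last first.
  (* With at most one index the pairings coincide, and [b] is absorbed into the two terms carrying
     [a]. *)
  exists (a + b / 2) => x y z w; rewrite Mab /wick.
  have eqI (u v : I) : u == v by apply/negbFE/(noneq (u, v)).
  by rewrite !eqI /=; field.
exists a; suff <- : b = 0 by [].
have yx : y == x = false by rewrite eq_sym (negPf xy).
(* The phase [i] on [x] multiplies [M x y x y] by [i^2 = -1], so that entry, which is [b],
   vanishes. *)
pose e u : C := if u == x then 'i%C else 1.
have e1 u : e u * (e u)^* = 1.
  rewrite /e; case: ifP => _; last by rewrite rmorph1 mulr1.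
  by apply/eqP; rewrite eq_complex/=; apply/andP; split; apply/eqP; ring.
have uV : unitary (fun u v => e u * (u == v)%:R).
  split=> u v.
    under eq_bigr do rewrite rmorphM/= conjC_nat mulrACA.
    rewrite -mulr_sumr sum_delta2.
    by have [->|_] := eqVneq u v; rewrite ?mulr0// mulr1 e1.
  under eq_bigr do rewrite rmorphM/= conjC_nat mulrACA [_^* * _]mulrC e1 mul1r
    ![_ == u]eq_sym ![_ == v]eq_sym.
  exact: sum_delta2.
have := Minv _ uV x y x y; rewrite (act4_monomial e id) !Mab /wick /e eqxx yx.
rewrite (negPf xy) /= rmorph1 !mulr1 !mul0r !addr0 !mulr0 !add0r.
rewrite (_ : 'i%C * 'i%C = -1); last by rewrite -expr2 sqr_i.
rewrite eqxx mul1r mulr1 => /eqP; rewrite mulN1r -subr_eq0 -opprD oppr_eq0 -mulr2n mulrn_eq0 /=.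
by move=> /eqP.
Qed.

Lemma unitary_trace V (F : I -> I -> C) : unitary V ->
  \sum_x \sum_x' V x x' * (\sum_y' (V x y')^* * F x' y') = \sum_x' F x' x'.
Proof.
move=> [_ col]; rewrite exchange_big; apply: eq_bigr => x' _.
under eq_bigr do rewrite mulr_sumr; rewrite exchange_big/=.
under eq_bigr => y' _.
  under eq_bigr do rewrite mulrA [V _ _ * _]mulrC.
  rewrite -mulr_suml col eq_sym; over.
exact: sum_delta.
Qed.

(** Each traced pair joins a factor [V] to a factor [V^*], so [unitary_trace] applies to the two
    pairs in turn. *)
Lemma act4_trace V N : unitary V ->
  \sum_x \sum_z act4 V N x x z z = \sum_x \sum_z N x x z z.
Proof.
move=> uV; under eq_bigr => x _.
  rewrite /act4 exchange_big; under eq_bigr => x' _.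
    rewrite -mulr_sumr exchange_big; under eq_bigr do
      rewrite -mulr_sumr (unitary_trace _ uV).
    over.
  over.
exact: (unitary_trace (fun x y => \sum_z N x y z z) uV).
Qed.

(** For a real [V] the four slots transform alike, so exchanging the middle two reduces this trace
    to [act4_trace]. *)
Lemma act4_trace_real V N : Defs.orthogonal V ->
  \sum_x \sum_y act4 V N x y x y = \sum_x \sum_y N x y x y.
Proof.
move=> oV; have uV := orthogonal_unitary oV.
rewrite -(act4_trace (fun x y z w => N x z y w) uV).
have [imV _] := oV; have rV x y : (V x y)^* = V x y.
  by have := imV x y; case: (V x y) => a b /= ->; congr Complex; rewrite oppr0.
apply: eq_bigr => x _; apply: eq_bigr => y _; apply: eq_bigr => x' _.
congr (_ * _); under eq_bigr do rewrite mulr_sumr.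
rewrite exchange_big; apply: eq_bigr => y' _; rewrite mulr_sumr.
by apply: eq_bigr => z' _; rewrite !rV mulrCA.
Qed.

Lemma wick_trace a b : \sum_(x : I) \sum_z wick a b x x z z =
  a * (#|I|%:R ^+ 2 + #|I|%:R) + b * #|I|%:R :> C.
Proof.
have E (x : I) : \sum_z wick a b x x z z = a * (#|I|%:R + 1) + b.
  rewrite /wick big_split/= -!mulr_sumr big_split/= !sum_delta eqxx mulr1.
  by under eq_bigr do rewrite !eqxx mulr1; rewrite sumr_const.
by under eq_bigr do rewrite E; rewrite sumr_const -mulr_natr; ring.
Qed.

Lemma wick_trace_real a b : \sum_(x : I) \sum_y wick a b x y x y =
  a * (2 * #|I|%:R) + b * #|I|%:R ^+ 2 :> C.
Proof.
have E (x : I) : \sum_y wick a b x y x y = a * 2 + b * #|I|%:R.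
  rewrite /wick big_split/= -!mulr_sumr big_split/= !sum_delta eqxx.
  by rewrite mul1r; under eq_bigr do rewrite eqxx; rewrite sumr_const.
by under eq_bigr do rewrite E; rewrite sumr_const -mulr_natr; ring.
Qed.

Definition mom4 (f : I -> C) x y z w : C := f x * (f y)^* * f z * (f w)^*.

Lemma act4_mom4 V f x y z w :
  act4 V (mom4 f) x y z w = mom4 (mulvec V f) x y z w.
Proof.
rewrite /mom4 /mulvec !rmorph_sum/= /act4 -!mulrA !mulr_suml.
apply: eq_bigr => x' _; rewrite -mulrA; congr (_ * _).
rewrite mulr_sumr; apply: eq_bigr => y' _.
rewrite rmorphM/= -!mulrA mulrCA; congr (_ * _).
rewrite !mulr_sumr; apply: eq_bigr => z' _.
rewrite !mulr_sumr; apply: eq_bigr => w' _.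
by rewrite rmorphM/=; ring.
Qed.

Lemma mulvec_mulop V W f : mulvec (mulop V W) f =1 mulvec V (mulvec W f).
Proof.
move=> x; rewrite /mulvec /mulop.
under eq_bigr do rewrite mulr_suml; rewrite exchange_big/=.
by apply: eq_bigr => y _; rewrite mulr_sumr; apply: eq_bigr => z _; rewrite mulrA.
Qed.

End TensorTraces.

(** * Contraction over a bipartition *)

(** Distributivity when the range of each index depends on the factor, obtained by passing to
    functions into the tagged sum. It factorises sums over the product basis into one sum per
    party. *)
Lemma sum_dffun_prod (K : comNzRingType) (I : finType) (T : I -> finType)
    (F : forall i, T i -> K) :
  \sum_(x : {dffun forall i, T i}) \prod_i F i (x i) = \prod_i \sum_j F i j.
Proof.
rewrite (reindex _ (onW_bij _ (@dffun_of_fprod_bij _ T))).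
pose F' i : {ffun T i -> K} := [ffun j => F i j].
transitivity (\sum_(t : fprod T) \prod_(i in I) F' i (t i)).
  by apply: eq_bigr => t _; apply: eq_bigr => i _; rewrite !ffunE.
rewrite big_fprod.
rewrite -(bigA_distr_big_dep (fun i => tagged_with T i)
  (fun i => untag 0 (F' i))); apply: eq_bigr => i _.
by rewrite -(big_tag (fun i => F' i) i); apply: eq_bigr => j _; rewrite ffunE.
Qed.

Section Contraction.
Context (R : realType) (n : nat) (d : 'I_n -> nat).
Local Notation C := R[i].
Local Notation I := (idx d).
Implicit Types (p q : {set 'I_n}) (x y z w : I).

Lemma card_idx : #|I|%:R = \prod_i (d i)%:R :> C.
Proof.
rewrite -sumr_const; transitivity (\sum_(x : I) \prod_(i < n) (1 : C)).
  by apply: eq_bigr => x _; rewrite big1.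
rewrite (sum_dffun_prod (fun i (j : 'I_(d i)) => 1 : C)).
by apply: eq_bigr => i _; rewrite sumr_const card_ord.
Qed.

Lemma agree_prod q x y : (agree q x y)%:R =
  \prod_i (if i \in q then (x i == y i)%:R else 1) :> C.
Proof.
have [/forall_inP xy|] := boolP (agree q x y).
  by rewrite big1// => i _; case: ifP => // /xy ->.
case/forall_inPn => i qi /negPf xy.
by rewrite (bigD1 i)//= qi xy mul0r.
Qed.

Lemma sum_agree q x : \sum_y (agree q x y)%:R = \prod_(i in ~: q) (d i)%:R :> C.
Proof.
rewrite (eq_bigr _ (fun y _ => agree_prod q x y)).
rewrite (sum_dffun_prod (fun i (j : 'I_(d i)) =>
  if i \in q then (x i == j)%:R else 1 : C)) [RHS]big_mkcond/=.
apply: eq_bigr => i _; rewrite inE; case: (i \in q) => /=.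
  by rewrite (bigD1 (x i))//= eqxx big1 ?addr0// => j /negPf; rewrite eq_sym => ->.
by rewrite sumr_const card_ord.
Qed.

Lemma agree_sym q x y : agree q x y = agree q y x.
Proof. by rewrite /agree; apply: eq_forallb => i; rewrite eq_sym. Qed.

Lemma agree_refl q x : agree q x x.
Proof. by apply/forall_inP. Qed.

Lemma agreeC_eq q x y : agree q x y && agree (~: q) x y = (x == y).
Proof.
apply/andP/eqP => [[/forall_inP xy /forall_inP xy']|->]; last by rewrite !agree_refl.
apply/ffunP => i; apply/eqP; have [/xy//|qi] := boolP (i \in q).
by apply: xy'; rewrite inE.
Qed.

Definition linked p x y z w :=
  [&& agree p x y, agree p z w, agree (~: p) x w & agree (~: p) y z].

Definition contract p (M : I -> I -> I -> I -> C) : C :=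
  \sum_x \sum_y \sum_z \sum_w (linked p x y z w)%:R * M x y z w.

(** Fix [x]. If [x = y] and [z = w], then [z] is free on [p] only; if [x = w] and [y = z], then [y]
    is free on the complement only; if [x = z] and [y = w], then [y] agrees with [x] on both blocks,
    hence equals it. The sum over [x] contributes the dimension. *)
Lemma contract_wick p a b : contract p (wick a b) =
  #|I|%:R * (a * (\prod_(i in p) (d i)%:R + \prod_(i in ~: p) (d i)%:R) + b).
Proof.
have S1 x : \sum_y \sum_z \sum_w
    (linked p x y z w)%:R * ((x == y)%:R * (z == w)%:R) =
    \prod_(i in p) (d i)%:R :> C.
  rewrite -[in RHS](finset.setCK p) -(sum_agree _ x).
  transitivity (\sum_y (x == y)%:R * (\sum_z \sum_w
     (z == w)%:R * (linked p x y z w)%:R : C)).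
    apply: eq_bigr => y _; rewrite mulr_sumr; apply: eq_bigr => z _.
    by rewrite mulr_sumr; apply: eq_bigr => w _; ring.
  rewrite sum_delta; apply: eq_bigr => z _; rewrite sum_delta.
  by rewrite /linked !agree_refl andbb.
have S2 x : \sum_y \sum_z \sum_w
    (linked p x y z w)%:R * ((x == w)%:R * (y == z)%:R) =
    \prod_(i in ~: p) (d i)%:R :> C.
  rewrite -(sum_agree _ x); apply: eq_bigr => y _.
  transitivity (\sum_z (y == z)%:R * (\sum_w
     (x == w)%:R * (linked p x y z w)%:R : C)).
    apply: eq_bigr => z _.
    by rewrite mulr_sumr; apply: eq_bigr => w _; ring.
  by rewrite sum_delta sum_delta /linked !agree_refl !andbT (agree_sym _ y) andbb.
have S3 x : \sum_y \sum_z \sum_w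
    (linked p x y z w)%:R * ((x == z)%:R * (y == w)%:R) = 1 :> C.
  transitivity (\sum_y (x == y)%:R * 1 : C); last by rewrite sum_delta.
  apply: eq_bigr => y _; rewrite mulr1.
  transitivity (\sum_z (x == z)%:R * (\sum_w
     (y == w)%:R * (linked p x y z w)%:R : C)).
    apply: eq_bigr => z _.
    by rewrite mulr_sumr; apply: eq_bigr => w _; ring.
  rewrite sum_delta sum_delta /linked (agree_sym _ y x) andbb.
  by rewrite andbA andbb agreeC_eq.
have E x : \sum_y \sum_z \sum_w (linked p x y z w)%:R * wick a b x y z w =
    a * (\prod_(i in p) (d i)%:R + \prod_(i in ~: p) (d i)%:R) + b.
  rewrite -[RHS]/(a * (_ + _) + b) -(S1 x) -(S2 x).
  rewrite -[X in _ + X]mulr1 -[X in b * X](S3 x) mulrDr !mulr_sumr -!big_split/=; apply: eq_bigr => y _.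
  rewrite !mulr_sumr -!big_split/=; apply: eq_bigr => z _.
  rewrite !mulr_sumr -!big_split/=; apply: eq_bigr => w _.
  by rewrite /wick; ring.
rewrite /contract (eq_bigr _ (fun x _ => E x)).
by rewrite sumr_const mulr_natl.
Qed.

Lemma purity_contract p (f : I -> C) : purity p f = complex.Re (contract p (mom4 f)).
Proof.
congr complex.Re; do 4 (apply: eq_bigr => ? _).
by rewrite /linked; case: ifP => _; rewrite ?mul1r ?mul0r.
Qed.

End Contraction.

(** Complementation exchanges the subsets containing the first party with the others, so they are
    half of all subsets; the full set is then discarded. *)
Lemma card_bipartitions n : (2 <= n)%N -> #|bipartitions n| = (2 ^ n.-1 - 1)%N.
Proof.
case: n => // n n2; pose A := [set p : {set 'I_n.+1} | ord0 \in p]%SET.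
have cA : #|A| = (2 ^ n)%N.
  have AC : #|~: A| = #|A|.
    rewrite -(card_imset _ (can_inj (@finset.setCK _))); apply: eq_card => p.
    apply/imsetP/idP => [[q]|pA].
      by rewrite !inE => qA ->; rewrite inE.
    by exists (~: p); rewrite ?finset.setCK// !inE negbK; rewrite inE in pA.
  have := cardsC A; rewrite AC addnn -cardsT -powersetT card_powerset cardsT.
  by rewrite card_ord expnS mul2n => /double_inj.
have -> : bipartitions n.+1 = (A :\ [set: 'I_n.+1])%SET.
  apply/setP => p; rewrite !inE andbCA; congr (_ && _).
  have -> : [exists i in p, val i == 0%N] = (ord0 \in p).
    apply/exists_inP/idP => [[i pi /eqP i0]|p0]; last by exists ord0.
    by rewrite (_ : ord0 = i)//; exact/val_inj.
  by apply/andP/idP => [[]//|p0]; split=> //; apply/set0Pn; exists ord0.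
by have := cardsD1 [set: 'I_n.+1]%SET A; rewrite cA !inE => ->; rewrite addKn.
Qed.

(** Evaluates the sum [B] of the theorem, which thus cancels the prefactor. *)
Lemma prod_one_add (K : comNzRingType) n (c : 'I_n -> K) :
  \sum_(e : {ffun 'I_n -> 'I_2}) \prod_(i < n) c i ^+ e i = \prod_i (c i + 1).
Proof.
rewrite -(bigA_distr_bigA (fun i (e : 'I_2) => c i ^+ e)).
by apply: eq_bigr => i _; rewrite !big_ord_recl big_ord0 /= addr0 addrC expr1.
Qed.

(** * Haar moments and independence *)

Section Moments.
Context (R : realType) (I : finType).
Local Notation C := R[i].

Lemma unit_vec_le1 (v : I -> C) j : unit_vec v -> `|v j| <= 1.
Proof.
move=> v1; rewrite -(@ler_sqr C) ?nnegrE// expr1n normCK -v1.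
by rewrite (bigD1 j)//= lerDl sumr_ge0// => i _; exact: mul_conjC_ge0.
Qed.

Lemma unitary_row (W : I -> I -> C) x : unitary W -> unit_vec (W x).
Proof. by move=> [row _]; rewrite /unit_vec row eqxx. Qed.

Lemma unitary_mulvec (W : I -> I -> C) v :
  unitary W -> unit_vec v -> unit_vec (mulvec W v).
Proof.
move=> uW; rewrite /unit_vec => <-; rewrite -(unitary_trace (fun x y => v x * (v y)^*) uW).
apply: eq_bigr => x _; rewrite /mulvec rmorph_sum/= mulr_suml.
apply: eq_bigr => y _; rewrite !mulr_sumr; apply: eq_bigr => z _.
by rewrite rmorphM/=; ring.
Qed.

Lemma unitary_mulop (V W : I -> I -> C) : unitary V -> unitary W -> unitary (mulop V W).
Proof.
move=> [rV cV] [rW cW]; rewrite /mulop; split=> x y.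
  under eq_bigr do rewrite rmorph_sum mulr_suml/=.
  rewrite exchange_big/= -rV; apply: eq_bigr => z _.
  under eq_bigr do rewrite mulr_sumr; rewrite exchange_big/=.
  transitivity (\sum_z' (z == z')%:R * (V x z * (V y z')^*)).
    apply: eq_bigr => z' _; rewrite -rW mulr_suml; apply: eq_bigr => u _.
    by rewrite rmorphM/=; ring.
  exact: sum_delta.
under eq_bigr do rewrite rmorph_sum mulr_suml/=.
rewrite exchange_big/= -cW; apply: eq_bigr => z _.
under eq_bigr do rewrite mulr_sumr; rewrite exchange_big/=.
transitivity (\sum_z' (z == z')%:R * ((W z x)^* * W z' y)).
  apply: eq_bigr => z' _; rewrite -cV mulr_suml; apply: eq_bigr => u _.
  by rewrite rmorphM/=; ring.
exact: sum_delta.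
Qed.

Lemma measurable_coord (V : pointedType) (G : set (set V)) (f : V -> R) :
  (forall B, measurable B -> G (f @^-1` B)) ->
  measurable_fun setT (f : g_sigma_algebraType G -> R).
Proof.
by move=> fG _ B mB; rewrite setTI; apply: sub_sigma_algebra; exact: fG.
Qed.

Lemma normc_le1_ReIm (z : C) : `|z| <= 1 ->
  `|complex.Re z| <= 1 /\ `|complex.Im z| <= 1.
Proof.
move=> z1; split; rewrite -lecR; first exact: le_trans (normc_ge_Re _) z1.
rewrite -normrN -ReiNIm (le_trans (normc_ge_Re _))//.
by rewrite normrM [`|'i%C|]normc_def/= expr0n expr1n add0r sqrtr1 mulr1.
Qed.

Definition unit_vectors : set (g_sigma_algebraType (@vec_cyl R I)) :=
  [set v | unit_vec v].

Definition unitaries : set (g_sigma_algebraType (@op_cyl R I)) :=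
  [set W | unitary W].

Lemma cbmeas_vec_coord j : cbmeas unit_vectors (fun v => v j).
Proof.
split; (split; [apply: measurable_coord => B mB; exists j, B; split => //; by [left|right]
  | exists 1 => v /(unit_vec_le1 j)/normc_le1_ReIm []//]).
Qed.

Lemma cbmeas_op_coord j k : cbmeas unitaries (fun W => W j k).
Proof.
split; (split; [apply: measurable_coord => B mB; exists j, k, B; split => //; by [left|right]
  | exists 1 => W /(unitary_row j)/(unit_vec_le1 k)/normc_le1_ReIm []//]).
Qed.

Section Closure.
Context (d : measure_display) (T : measurableType d).

Lemma cbmeas_mom4 (S : set T) (f : T -> I -> C) x y z w :
  (forall j, cbmeas S (fun t => f t j)) ->
  cbmeas S (fun t => mom4 (f t) x y z w).
Proof.
move=> bf; apply: cbmeasM; last by apply: cbmeasC.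
by apply: cbmeasM => //; apply: cbmeasM => //; apply: cbmeasC.
Qed.

Lemma cbmeas_mulvec (S : set T) (W : T -> I -> I -> C) (f : T -> I -> C) x :
  (forall j k, cbmeas S (fun t => W t j k)) ->
  (forall j, cbmeas S (fun t => f t j)) ->
  cbmeas S (fun t => mulvec (W t) (f t) x).
Proof. by move=> bW bf; apply: cbmeas_sum => j; apply: cbmeasM. Qed.

Lemma cbmeas_mulop (S : set T) (V W : T -> I -> I -> C) x y :
  (forall j k, cbmeas S (fun t => V t j k)) ->
  (forall j k, cbmeas S (fun t => W t j k)) ->
  cbmeas S (fun t => mulop (V t) (W t) x y).
Proof. by move=> bV bW; apply: cbmeas_sum => j; apply: cbmeasM. Qed.

Lemma cbmeas_act4 (S : set T) (W : T -> I -> I -> C) N x y z w :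
  (forall j k, cbmeas S (fun t => W t j k)) ->
  (forall x y z w, cbmeas S (fun t => N t x y z w)) ->
  cbmeas S (fun t => act4 (W t) (N t) x y z w).
Proof.
move=> bW bN; apply: cbmeas_sum => x'; apply: cbmeasM => //.
apply: cbmeas_sum => y'; apply: cbmeasM; first exact: cbmeasC.
apply: cbmeas_sum => z'; apply: cbmeasM => //.
by apply: cbmeas_sum => w'; apply: cbmeasM => //; exact: cbmeasC.
Qed.

Lemma act4_cmean (P : probability T R) (V : I -> I -> C) N x y z w :
  (forall x y z w, cbmeas setT (fun t => N t x y z w)) ->
  act4 V (fun x y z w => cmean P (fun t => N t x y z w)) x y z w =
  cmean P (fun t => act4 V (N t) x y z w).
Proof.
move=> bN; have bc c : cbmeas setT (fun _ : T => c : C) by exact: cbmeas_cst.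
have b1 x' y' z' : cbmeas setT (fun t => \sum_w' (V w w')^* * N t x' y' z' w').
  by apply: cbmeas_sum => w'; exact: cbmeasM.
have b2 x' y' : cbmeas setT (fun t => \sum_z' V z z' *
    \sum_w' (V w w')^* * N t x' y' z' w').
  by apply: cbmeas_sum => z'; exact: cbmeasM.
have b3 x' : cbmeas setT (fun t => \sum_y' (V y y')^* * \sum_z' V z z' *
    \sum_w' (V w w')^* * N t x' y' z' w').
  by apply: cbmeas_sum => y'; exact: cbmeasM.
rewrite /act4 cmean_sum; last by move=> x'; exact: cbmeasM.
apply: eq_bigr => x' _; rewrite cmeanZ//; congr (_ * _).
rewrite cmean_sum; last by move=> y'; exact: cbmeasM.
apply: eq_bigr => y' _; rewrite cmeanZ//; congr (_ * _).
rewrite cmean_sum; last by move=> z'; exact: cbmeasM.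
apply: eq_bigr => z' _; rewrite cmeanZ//; congr (_ * _).
rewrite cmean_sum; last by move=> w'; exact: cbmeasM.
by apply: eq_bigr => w' _; rewrite cmeanZ.
Qed.

End Closure.

Lemma mom4_sym (f : I -> C) x y z w : mom4 f x y z w = mom4 f z y x w.
Proof. by rewrite /mom4; ring. Qed.

Lemma unit_vec_trace (f : I -> C) : unit_vec f ->
  \sum_x \sum_z mom4 f x x z z = 1.
Proof.
move=> f1; transitivity ((\sum_x f x * (f x)^*) * (\sum_x f x * (f x)^*)).
  rewrite mulr_suml; apply: eq_bigr => x _; rewrite mulr_sumr.
  by apply: eq_bigr => z _; rewrite /mom4 !mulrA.
by rewrite f1 mulr1.
Qed.

(** Unitary invariance gives the shape of the moment tensor, and the unit norm fixes its only
    coefficient through [wick_trace]. *)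
Lemma vec_moment (d : measure_display) (T : measurableType d)
    (P : probability T R) (X : T -> I -> C) :
  rand_elt (@vec_cyl R I) X -> (forall t, unit_vec (X t)) ->
  (forall V, unitary V ->
     same_law P (@vec_cyl R I) (fun t => mulvec V (X t)) X) ->
  exists2 a, a * (#|I|%:R ^+ 2 + #|I|%:R) = 1 &
    forall x y z w, cmean P (fun t => mom4 (X t) x y z w) = wick a 0 x y z w.
Proof.
move=> rX uX lX; have bX j : cbmeas setT (fun t => X t j).
  exact: (cbmeas_comp rX uX (cbmeas_vec_coord j)).
have bm x y z w : cbmeas setT (fun t => mom4 (X t) x y z w) by exact: cbmeas_mom4.
have [|V uV x y z w|a E] := @inv_wick_unitary R I (fun x y z w => cmean P (fun t => mom4 (X t) x y z w)).
- by move=> x y z w; apply: eq_cmean => t; exact: mom4_sym.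
- rewrite act4_cmean//; under eq_cmean do rewrite act4_mom4.
  apply: (@same_law_cmean R _ _ unit_vectors _ _ P _ _
    (fun v => mom4 v x y z w) (lX V uV)) => //.
  + by move=> t; exact: unitary_mulvec.
  + apply: cbmeas_mom4 => j; apply: cbmeas_mulvec => // k l; exact: cbmeas_cst.
  + by apply: cbmeas_mom4 => j; exact: cbmeas_vec_coord.
exists a => //; rewrite -[LHS]addr0 -[X in _ + X](mul0r #|I|%:R) -wick_trace.
under eq_bigr do under eq_bigr do rewrite -E.
rewrite -[RHS](cmean_cst P) -cmean_sum2//.
by apply: eq_cmean => t; exact: unit_vec_trace.
Qed.

End Moments.

(** * Mean of a product of independent variables *)

Section Independence.
Context (R : realType) (d : measure_display) (T : measurableType d).
Context (P : probability T R) (I : finType) (X : I -> T -> R).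
Hypothesis bX : forall i, bmeas setT (X i).
Hypothesis X01 : forall i t, 0 <= X i t <= 1.
Hypothesis indX : forall r : I -> R,
  P (\bigcap_(i in [set: I]) [set t | r i <= X i t]) =
  (\prod_i P [set t | (r i <= X i t)%R])%E.

Let mX i r : measurable [set t | r <= X i t].
Proof.
have [mXi _] := bX i.
by rewrite -[X in measurable X]setTI; apply: measurable_fun_le.
Qed.

(* The factors are converted one by one from indicators to the variables,
   the remaining product playing the role of a weight in the layer-cake lemma. *)
Lemma indep_mean_prod :
  \int[P]_t (\prod_i X i t) = \prod_i \int[P]_t X i t.
Proof.
pose Y (s : seq I) (r : I -> R) i t :=
  if i \in s then X i t else \1_[set t | r i <= X i t] t.
have bY s r i : bmeas setT (Y s r i).
  by rewrite /Y; case: (i \in s) => //; exact: bmeas_indic.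
have Y01 s r i t : 0 <= Y s r i t <= 1.
  rewrite /Y; case: (i \in s) => //; rewrite indicE.
  by case: (_ \in _); rewrite ?lexx ?ler01.
have le01 (J : eqType) (l : seq J) (Q : pred J) (y : J -> R) : (forall i, 0 <= y i <= 1) ->
    `|\prod_(i <- l | Q i) y i| <= 1.
  move=> y01; rewrite normr_prod; elim: l => [|j l IH]; first by rewrite big_nil.
  rewrite big_cons; case: (Q j) => //; rewrite mulr_ile1 ?prodr_ge0//.
  by have /andP[y0 y1] := y01 j; rewrite ger0_norm.
have mean01 s r i : 0 <= \int[P]_t Y s r i t <= 1.
  rewrite Rintegral_ge0/=; last by move=> t _; have /andP[] := Y01 s r i t.
  apply: le_trans (ler_norm _) _; apply: Rintegral_abs_le => // t.
  by have /andP[y0 y1] := Y01 s r i t; rewrite ger0_norm.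
(* [s] lists the factors already converted. The thresholds are quantified inside the induction
   because each step varies the one at [j]. *)
suff main s : uniq s -> forall r,
    \int[P]_t (\prod_i Y s r i t) = \prod_i \int[P]_t Y s r i t.
  have := main (enum I) (enum_uniq I) (fun=> 0).
  under [X in X = _ -> _]eq_Rintegral => t _ do
    under eq_bigr => i _ do rewrite /Y mem_enum inE.
  move=> ->; apply: eq_bigr => i _; apply: eq_Rintegral => t _.
  by rewrite /Y mem_enum inE.
elim: s => [_ r|j s IH /=/andP[js us] r].
  under eq_Rintegral => t _ do rewrite /Y/=.
  pose A := \bigcap_(i in [set: I]) [set t | r i <= X i t].
  transitivity (\int[P]_t \1_A t).
    apply: eq_Rintegral => t _; rewrite indicE.
    have [tA|tA] := boolP (t \in A).
      rewrite big1// => i _; rewrite indicE mem_set//.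
      by move/set_mem : tA; exact.
    have [i ti] : exists i, ~~ (r i <= X i t).
      apply/existsP; rewrite -negb_forall; apply: contra tA => /forallP tA.
      by apply/mem_set => i _; exact: tA.
    by rewrite (bigD1 i)//= indicE memNset ?mul0r//; exact/negP.
  rewrite Rintegral_indic; last first.
    by apply: fin_bigcap_measurable => //; exact: finite_finset.
  rewrite indX; transitivity (fine (\prod_i (\int[P]_t Y [::] r i t)%:E)%E).
    congr fine; apply: eq_bigr => i _.
    by rewrite [in RHS]Rintegral_indic// fineK// fin_num_measure.
  by rewrite prodEFin.
have Yj r' i t : i != j -> Y (j :: s) r' i t = Y s r' i t.
  by move=> /negPf ij; rewrite /Y inE ij.
pose Z t := \prod_(i | i != j) Y s r i t.
pose c := \prod_(i | i != j) \int[P]_t Y s r i t.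
have bZ : bmeas setT Z by exact: bmeas_prod.
transitivity (\int[P]_t (Z t * X j t)).
  apply: eq_Rintegral => t _; rewrite (bigD1 j)//= {1}/Y mem_head mulrC.
  by congr (_ * _); apply: eq_bigr => i /Yj ->.
transitivity (\int[P]_t (c * X j t)).
  apply: eq_Rintegral_layer => //.
  - exact: bmeas_cst.
  - by move=> t; exact: le01.
  - by move=> t; exact: le01.
  (* Since [j] is not in [s], the factor at [j] is still an indicator: the induction hypothesis with
     threshold [rho] there is exactly the equality required by the layer-cake lemma. *)
  move=> rho; pose r' i := if i == j then rho else r i.
  have Yr i t : i != j -> Y s r' i t = Y s r i t.
    by move=> /negPf ij; rewrite /Y /r' ij.
  have := IH us r'.
  rewrite (bigD1 j)//=.
  rewrite [X in _ * X](_ : _ = c); last first.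
    by apply: eq_bigr => i ij; apply: eq_Rintegral => t _; rewrite Yr.
  rewrite mulrC -RintegralZl//; last exact: bmeas_integrable.
  move=> E; transitivity (\int[P]_t \prod_i Y s r' i t).
    apply: eq_Rintegral => t _; rewrite (bigD1 j)//= mulrC.
    rewrite {1}/Y (negPf js) /r' eqxx; congr (_ * _).
    by apply: eq_bigr => i /Yr.
  rewrite E; apply: eq_Rintegral => t _.
  by rewrite /Y (negPf js) /r' eqxx.
rewrite RintegralZl//; last exact: bmeas_integrable.
rewrite [RHS](bigD1 j)//= mulrC; congr (_ * _).
  by apply: eq_Rintegral => t _; rewrite /Y mem_head.
by apply: eq_bigr => i ij; apply: eq_Rintegral => t _; rewrite Yj.
Qed.

End Independence.

(** * Product states *)

Section SeparableStates.
Context (R : realType) (n : nat) (d : 'I_n -> nat).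
Local Notation C := R[i].
Local Notation I := (idx d).
Local Notation "x %:RC" := (real_complex R x) (at level 1, format "x %:RC").

(** The bilinear square [f^T f], without conjugation; it is multiplicative on product states. *)
Definition sqsum (J : finType) (f : J -> C) : C := \sum_x f x ^+ 2.

Lemma mom4_trace_real (J : finType) (f : J -> C) :
  \sum_x \sum_y mom4 f x y x y = `|sqsum f| ^+ 2.
Proof.
rewrite normCK /sqsum rmorph_sum/= mulr_suml; apply: eq_bigr => x _.
rewrite mulr_sumr; apply: eq_bigr => y _.
by rewrite /mom4 rmorphXn/=; ring.
Qed.

Lemma cbmeas_sqsum (d1 : measure_display) (T : measurableType d1) (S : set T)
    (J : finType) (f : T -> J -> C) :
  (forall j, cbmeas S (fun t => f t j)) ->
  cbmeas S (fun t => `|sqsum (f t)| ^+ 2).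
Proof.
move=> bf; have b : cbmeas S (fun t => sqsum (f t)).
  by apply: cbmeas_sum => j; exact: (cbmeasM (bf j) (bf j)).
by under eq_fun do rewrite normCK; apply: cbmeasM => //; exact: cbmeasC.
Qed.

Lemma sqsum_le1 (J : finType) (f : J -> C) : unit_vec f -> `|sqsum f| <= 1.
Proof.
move=> <-; apply: le_trans (ler_norm_sum _ _ _) _; apply: ler_sum => x _.
by rewrite normrX normCK.
Qed.

Lemma sqsum_sep (f : forall i, 'I_(d i) -> C) :
  sqsum (sep_state f) = \prod_i sqsum (f i).
Proof.
rewrite /sqsum -(sum_dffun_prod (fun i j => f i j ^+ 2)).
by apply: eq_bigr => x _; rewrite /sep_state -prodrXl.
Qed.

Lemma sep_unit_vec (f : forall i, 'I_(d i) -> C) :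
  (forall i, unit_vec (f i)) -> unit_vec (sep_state f).
Proof.
move=> f1; transitivity (\prod_i \sum_j f i j * (f i j)^* : C); last by rewrite big1// => i _; exact: f1.
rewrite -(sum_dffun_prod (fun i j => f i j * (f i j)^*)).
by apply: eq_bigr => x _; rewrite /sep_state rmorph_prod -big_split.
Qed.

Context (d0 : measure_display) (Om : measurableType d0) (P : probability Om R).
Context (psi : Om -> forall i : 'I_n, 'I_(d i) -> C).
Arguments psi : clear implicits.
Hypothesis d_gt0 : forall i, (0 < d i)%N.
Hypothesis psiP : random_product_state P psi.

Lemma cbmeas_psi i j : cbmeas setT (fun w => psi w i j).
Proof.
case: psiP => r u _ _.
exact: (cbmeas_comp (r i) (fun w => u i w) (cbmeas_vec_coord R j)).
Qed.

Lemma cbmeas_sep x : cbmeas setT (fun w => sep_state (psi w) x).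
Proof. by apply: cbmeas_prod => i; exact: cbmeas_psi. Qed.

Lemma unit_sep w : unit_vec (sep_state (psi w)).
Proof. by apply: sep_unit_vec => i; case: psiP. Qed.

Definition sep_moment x y z w : C := cmean P (fun o => mom4 (sep_state (psi o)) x y z w).

Lemma sep_moment_trace : \sum_x \sum_z sep_moment x x z z = 1.
Proof.
rewrite -[RHS](cmean_cst P) -cmean_sum2; last first.
  by move=> x z; apply: cbmeas_mom4 => j; exact: cbmeas_sep.
by apply: eq_cmean => o; apply: unit_vec_trace; exact: unit_sep.
Qed.

Let X i w : R := complex.Re (`|sqsum (psi w i)| ^+ 2).

Let XE i w : `|sqsum (psi w i)| ^+ 2 = (X i w)%:RC.
Proof.
have : `|sqsum (psi w i)| ^+ 2 \is Num.real by rewrite ger0_real// exprn_ge0.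
by move=> /RRe_real.
Qed.

Let cbX i : cbmeas setT (fun w => (X i w)%:RC).
Proof.
under eq_fun do rewrite -XE.
by apply: cbmeas_sqsum => j; exact: cbmeas_psi.
Qed.

Let X01 i w : 0 <= X i w <= 1.
Proof.
have [_ u _ _] := psiP.
by rewrite -!lecR -XE exprn_ge0//= expr_le1//; exact: sqsum_le1.
Qed.

Lemma cmean_real (f : Om -> R) : cmean P (fun w => (f w)%:RC) = (\int[P]_w f w)%:RC.
Proof. by congr Complex; exact: Rintegral_prob_cst. Qed.

(** In dimension [d] the coefficients are [a = 1 / (d (d + 1))] and [b = 0], so the unconjugated
    trace [wick_trace_real] is [2 a d]. *)
Let meanX i : \int[P]_w X i w = 2 / ((d i)%:R + 1).
Proof.
have [r u l _] := psiP.
have [a a1 E] := vec_moment (r i) (fun w => u i w) (l i).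
apply: (@complexI R); rewrite -cmean_real; under eq_cmean do rewrite -XE -mom4_trace_real.
have bpsi (j : 'I_(d i)) := cbmeas_psi j.
rewrite cmean_sum2; last by move=> x y; exact: cbmeas_mom4.
under eq_bigr do under eq_bigr do rewrite E.
rewrite wick_trace_real mul0r addr0; rewrite card_ord in a1 *.
have D0 : (d i)%:R != 0 :> C by rewrite pnatr_eq0 -lt0n.
have D1 : (d i)%:R + 1 != 0 :> C by rewrite natr1 pnatr_eq0.
rewrite natr1 fmorph_div/= !rmorph_nat -[(d i).+1%:R]natr1.
have -> : a = ((d i)%:R * ((d i)%:R + 1))^-1.
  have DD : (d i)%:R * ((d i)%:R + 1) != 0 :> C by rewrite mulf_neq0.
  by apply: (mulIf DD); rewrite mulVf// -[RHS]a1; ring.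
by field; rewrite D0 D1.
Qed.

Lemma sep_moment_trace_real :
  \sum_x \sum_y sep_moment x y x y = (\prod_i (2 / ((d i)%:R + 1)))%:RC.
Proof.
rewrite -cmean_sum2; last first.
  by move=> x z; apply: cbmeas_mom4 => j; exact: cbmeas_sep.
transitivity (cmean P (fun w => (\prod_i X i w)%:RC)).
  apply: eq_cmean => w; rewrite mom4_trace_real sqsum_sep normr_prod -prodrXl.
  by rewrite rmorph_prod; apply: eq_bigr => i _; rewrite XE.
rewrite cmean_real indep_mean_prod //; last 2 first.
- by move=> i; have [] := cbX i.
- move=> r; have [_ _ _ ind] := psiP.
  (* Each superlevel set of [X i] is an event on the vector [psi_i] alone, which brings it under the
     independence clause of [random_product_state]. *)
  pose A i : set ('I_(d i) -> C) := [set v | r i <= complex.Re (`|sqsum v| ^+ 2)].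
  apply: (ind A) => i.
  have b : cbmeas (@unit_vectors R 'I_(d i)) (fun v => `|sqsum v| ^+ 2).
    by apply: cbmeas_sqsum => j; exact: cbmeas_vec_coord.
  have [[mRe _] _] := b.
  rewrite -[X in <<s _ >> X]setTI (_ : A i = (fun v => complex.Re (`|sqsum v| ^+ 2)) @^-1` `[r i, +oo[).
    by apply: mRe => //; exact: measurable_itv.
  by apply/seteqP; split => v; rewrite /A /= in_itv/= andbT.
by rewrite (eq_bigr _ (fun i _ => meanX i)).
Qed.

End SeparableStates.

(** * Averages over gates *)

Section HaarMoments.
Context (R : realType) (n : nat) (d : 'I_n -> nat).
Local Notation C := R[i].
Local Notation I := (idx d).
Local Notation "x %:RC" := (real_complex R x) (at level 1, format "x %:RC").

(** The one-tangle extended to an affine function of an arbitrary tensor, so that it commutes with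
    both averages. *)
Definition mean_tangle (M : I -> I -> I -> I -> C) : C :=
  (2 ^+ n.-1 - 1)^-1 * \sum_(p in bipartitions n) 2 * (1 - contract p M).

Lemma one_tangle_mean_tangle (f : I -> C) :
  one_tangle f = complex.Re (mean_tangle (mom4 f)).
Proof.
have ReZ (r : R) (z : C) : complex.Re (r%:RC * z) = r * complex.Re z.
  by rewrite ReM /= mul0r subr0.
have -> : mean_tangle (mom4 f) = ((2 ^+ n.-1 - 1)^-1)%:RC *
    \sum_(p in bipartitions n) 2%:RC * (1 - contract p (mom4 f)).
  by rewrite /mean_tangle fmorphV rmorphB rmorphXn/= rmorph1 rmorph_nat.
rewrite ReZ /one_tangle; congr (_ * _).
rewrite (big_morph _ (@ReD R) (erefl : complex.Re (0 : C) = 0)).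
by apply: eq_bigr => p _; rewrite ReZ ReD /tau purity_contract; case: (contract _ _).
Qed.

Lemma cbmeas_contract (d1 : measure_display) (T : measurableType d1) (S : set T)
    p (F : T -> I -> I -> I -> I -> C) :
  (forall x y z w, cbmeas S (fun t => F t x y z w)) ->
  cbmeas S (fun t => contract p (F t)).
Proof.
move=> bF; do 4 (apply: cbmeas_sum => ?).
by apply: cbmeasM => //; exact: cbmeas_cst.
Qed.

Lemma cmean_contract (d1 : measure_display) (T : measurableType d1)
    (P : probability T R) p (F : T -> I -> I -> I -> I -> C) :
  (forall x y z w, cbmeas setT (fun t => F t x y z w)) ->
  cmean P (fun t => contract p (F t)) =
  contract p (fun x y z w => cmean P (fun t => F t x y z w)).
Proof.
move=> bF; have b x y z w : cbmeas setT (fun t => (linked p x y z w)%:R * F t x y z w).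
  by apply: cbmeasM => //; exact: cbmeas_cst.
rewrite /contract cmean_sum2; last by move=> x y; do 2 (apply: cbmeas_sum => ?).
apply: eq_bigr => x _; apply: eq_bigr => y _; rewrite cmean_sum2//.
by apply: eq_bigr => z _; apply: eq_bigr => w _; rewrite cmeanZ.
Qed.

Lemma cmean_mean_tangle (d1 : measure_display) (T : measurableType d1)
    (P : probability T R) (F : T -> I -> I -> I -> I -> C) :
  (forall x y z w, cbmeas setT (fun t => F t x y z w)) ->
  cmean P (fun t => mean_tangle (F t)) =
  mean_tangle (fun x y z w => cmean P (fun t => F t x y z w)).
Proof.
move=> bF; have b p : cbmeas setT (fun t => - 1 * contract p (F t)).
  by apply: cbmeasM; [exact: cbmeas_cst | exact: cbmeas_contract].
have b1 p : cbmeas setT (fun t => 1 - contract p (F t)).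
  apply: cbmeasD; first exact: cbmeas_cst.
  by under eq_fun do rewrite -mulN1r.
have b2 p : cbmeas setT (fun t => 2 * (1 - contract p (F t))).
  by apply: cbmeasM => //; exact: cbmeas_cst.
rewrite cmeanZ; last exact: cbmeas_sum.
congr (_ * _); rewrite cmean_sum//; apply: eq_bigr => p _.
rewrite cmeanZ//; congr (_ * _); rewrite -cmean_contract//.
transitivity (cmean P (fun=> 1) + cmean P (fun t => - 1 * contract p (F t))).
  rewrite -cmeanD//; last exact: cbmeas_cst.
  by apply: eq_cmean => t; rewrite mulN1r.
by rewrite cmean_cst cmeanZ ?mulN1r//; exact: cbmeas_contract.
Qed.

Context (d0 : measure_display) (Om : measurableType d0) (P : probability Om R).
Context (psi : Om -> forall i : 'I_n, 'I_(d i) -> C).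
Hypothesis d_gt0 : forall i, (0 < d i)%N.
Hypothesis psiP : random_product_state P psi.

Lemma act4_sep_moment (W : I -> I -> C) x y z w :
  act4 W (sep_moment P psi) x y z w =
  cmean P (fun o => mom4 (mulvec W (sep_state (psi o))) x y z w).
Proof.
rewrite act4_cmean; last first.
  by move=> *; apply: cbmeas_mom4 => j; exact: cbmeas_sep psiP _.
by apply: eq_cmean => o; rewrite act4_mom4.
Qed.

(** After this the average over states survives only as a constant tensor, and the dependence on [W]
    is polynomial. *)
Lemma entangling_powerE (W : I -> I -> C) :
  entangling_power P psi W = complex.Re (mean_tangle (act4 W (sep_moment P psi))).
Proof.
have -> : act4 W (sep_moment P psi) = fun x y z w =>
    cmean P (fun o => mom4 (mulvec W (sep_state (psi o))) x y z w).
  by do 4 (apply/funext => ?); exact: act4_sep_moment.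
rewrite -cmean_mean_tangle; last first.
  move=> *; apply: cbmeas_mom4 => j; apply: cbmeas_mulvec => *; first exact: cbmeas_cst.
  exact: cbmeas_sep psiP _.
by apply: eq_Rintegral => o _; rewrite -one_tangle_mean_tangle.
Qed.

(** Compatibility of the action with products, read off from the vectors under the mean instead of
    by rearranging eight nested sums. *)
Lemma act4_mulop_sep_moment (V W : I -> I -> C) :
  act4 (mulop V W) (sep_moment P psi) = act4 V (act4 W (sep_moment P psi)).
Proof.
have -> : act4 W (sep_moment P psi) = fun x y z w =>
    cmean P (fun o => mom4 (mulvec W (sep_state (psi o))) x y z w).
  by do 4 (apply/funext => ?); exact: act4_sep_moment.
do 4 (apply/funext => ?); rewrite act4_sep_moment act4_cmean.
  by apply: eq_cmean => o; rewrite act4_mom4 /mom4 !mulvec_mulop.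
move=> *; apply: cbmeas_mom4 => j; apply: cbmeas_mulvec => *; first exact: cbmeas_cst.
exact: cbmeas_sep psiP _.
Qed.

Context (d1 : measure_display) (T : measurableType d1) (mu : probability T R).
Context (U : T -> I -> I -> C).
Hypothesis rU : rand_elt (@op_cyl R I) U.
Hypothesis uU : forall t, unitary (U t).

Lemma cbmeas_U j k : cbmeas setT (fun t => U t j k).
Proof. exact: (cbmeas_comp rU uU (cbmeas_op_coord R j k)). Qed.

Definition out_moment x y z w : C :=
  cmean mu (fun t => act4 (U t) (sep_moment P psi) x y z w).

Let bU x y z w : cbmeas setT (fun t => act4 (U t) (sep_moment P psi) x y z w).
Proof.
by apply: cbmeas_act4 => *; [exact: cbmeas_U | exact: cbmeas_cst].
Qed.

Lemma mean_entangling_power :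
  \int[mu]_t entangling_power P psi (U t) = complex.Re (mean_tangle out_moment).
Proof.
rewrite -cmean_mean_tangle//; apply: eq_Rintegral => t _.
exact: entangling_powerE.
Qed.

Lemma out_moment_sym x y z w : out_moment x y z w = out_moment z y x w.
Proof.
apply: eq_cmean => t; rewrite !act4_sep_moment.
by apply: eq_cmean => o; exact: mom4_sym.
Qed.

(** [V] moves inside the mean and merges with [U t] into [mulop V (U t)], which has the law of
    [U]. *)
Lemma out_moment_inv V : unitary V ->
  same_law mu (@op_cyl R I) (fun t => mulop V (U t)) U ->
  forall x y z w, act4 V out_moment x y z w = out_moment x y z w.
Proof.
move=> uV lV x y z w; rewrite act4_cmean//.
under eq_cmean do rewrite -act4_mulop_sep_moment.
apply: (@same_law_cmean R _ _ (@unitaries R I) _ _ mu _ _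
  (fun W => act4 W (sep_moment P psi) x y z w) lV) => //.
- by move=> t; exact: unitary_mulop.
- apply: cbmeas_act4 => *; last exact: cbmeas_cst.
  by apply: cbmeas_mulop => *; [exact: cbmeas_cst | exact: cbmeas_U].
- by apply: cbmeas_act4 => *; [exact: cbmeas_op_coord | exact: cbmeas_cst].
Qed.

Lemma out_moment_trace : \sum_x \sum_z out_moment x x z z = 1.
Proof.
rewrite -cmean_sum2// -[RHS](cmean_cst mu); apply: eq_cmean => t.
by rewrite act4_trace//; exact: sep_moment_trace.
Qed.

Lemma out_moment_trace_real : (forall t, Defs.orthogonal (U t)) ->
  \sum_x \sum_y out_moment x y x y = (\prod_i (2 / ((d i)%:R + 1)))%:RC.
Proof.
move=> oU; rewrite -cmean_sum2// -[RHS](cmean_cst mu); apply: eq_cmean => t.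
by rewrite act4_trace_real//; exact: sep_moment_trace_real.
Qed.

Lemma mean_tangle_wick (a b : R) : (2 <= n)%N ->
  let D : R := \prod_i (d i)%:R in
  mean_tangle (@wick R I a%:RC b%:RC) =
  (2 * (1 - D * (a / (2 ^+ n.-1 - 1) * (\sum_(p in bipartitions n)
     (\prod_(i in p) (d i)%:R + \prod_(i in ~: p) (d i)%:R)) + b)))%:RC.
Proof.
move=> n2 D.
pose c (p : {set 'I_n}) : R := \prod_(i in p) (d i)%:R + \prod_(i in ~: p) (d i)%:R.
have rp (Q : pred 'I_n) : (\prod_(i | Q i) (d i)%:R)%:RC = \prod_(i | Q i) (d i)%:R.
  by rewrite rmorph_prod; apply: eq_bigr => i _; rewrite /= rmorph_nat.
have E p : 2 * (1 - contract (d := d) p (wick a%:RC b%:RC)) = (2 * (1 - D * (a * c p + b)))%:RC.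
  rewrite contract_wick card_idx /c !(rmorphM, rmorphB, rmorphD, rmorph1, rmorph_nat)/=.
  by rewrite /D !rp; ring.
rewrite /mean_tangle (eq_bigr _ (fun p _ => E p)).
have -> : (2 ^+ n.-1 - 1)^-1 = ((2 ^+ n.-1 - 1)^-1)%:RC :> C.
  by rewrite fmorphV rmorphB rmorphXn/= rmorph1 rmorph_nat.
rewrite -rmorph_sum -rmorphM; congr (real_complex R _).
have N : (#|bipartitions n|%:R : R) = 2 ^+ n.-1 - 1.
  by rewrite card_bipartitions// natrB ?natrX// expn_gt0.
have N0 : 2 ^+ n.-1 - 1 != 0 :> R.
  by rewrite subr_eq0 -natrX (eqr_nat R _ 1) -[X in _ == X](expn0 2) eqn_exp2l//; lia.
rewrite (eq_bigr (fun p => 2 * (1 - D * b) - 2 * D * a * c p)); last by move=> p _; ring.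
(* The part independent of [p] is repeated once per bipartition and cancels the normalisation, so
   the latter remains only under [a]. *)
rewrite big_split/= sumrN sumr_const -mulr_sumr -(mulr_natr (2 * (1 - D * b))) N.
by rewrite /c; field.
Qed.

End HaarMoments.

(** * The two Haar averages *)

Unset Implicit Arguments.

Theorem theorem6 (R : realType) (n : nat) (d : 'I_n -> nat)
  (d0 : measure_display) (Om : measurableType d0) (P : probability Om R)
  (psi : Om -> forall i : 'I_n, 'I_(d i) -> R[i])
  (d1 : measure_display) (T1 : measurableType d1) (mu1 : probability T1 R)
  (U : T1 -> idx d -> idx d -> R[i])
  (d2 : measure_display) (T2 : measurableType d2) (mu2 : probability T2 R)
  (O : T2 -> idx d -> idx d -> R[i]) :
  (2 <= n)%N -> (forall i, (0 < d i)%N) ->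
  random_product_state P psi ->
  haar_unitary mu1 U ->
  haar_orthogonal mu2 O ->
  let B : R := \sum_(e : {ffun 'I_n -> 'I_2}) \prod_(i < n) (d i)%:R ^+ e i in
  let C : R := \sum_(p in bipartitions n)
                 ((\prod_(i in p) (d i)%:R) + \prod_(i in ~: p) (d i)%:R) in
  let D : R := \prod_(i < n) (d i)%:R in
  let f : R := \prod_(i < n) ((d i)%:R + 1)^-1 in
  Rintegral mu1 setT (fun t => entangling_power P psi (U t))
    = 2 * (1 - f * (B * C / ((2 ^+ n.-1 - 1) * (D + 1))))
  /\
  (1 < D ->
   Rintegral mu2 setT (fun t => entangling_power P psi (O t))
    = 2 * (1 - f * ((2 ^+ n * (D + 1) - 2 * B
                     + (B * D - 2 ^+ n) / (2 ^+ n.-1 - 1) * C)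
                    / ((D - 1) * (D + 2))))).
Proof.
move=> n2 d_gt0 psiP [rU uU lU] [rO oO lO] B C D f.
have fB : f * B = 1.
  rewrite /B (prod_one_add (fun i => (d i)%:R : R)) /f -big_split/= big1// => i _.
  by rewrite mulVf// natr1 pnatr_eq0.
have D_gt0 : 0 < D by rewrite prodr_gt0// => i _; rewrite ltr0n.
have D0 : D != 0 by rewrite gt_eqF.
have D1 : D + 1 != 0 by rewrite gt_eqF// addr_gt0.
have cardI : #|idx d|%:R = real_complex R D.
  by rewrite card_idx rmorph_prod; apply: eq_bigr => i _; rewrite /= rmorph_nat.
have N0 : 2 ^+ n.-1 - 1 != 0 :> R.
  by rewrite subr_eq0 -natrX (eqr_nat R _ 1) -[X in _ == X](expn0 2) eqn_exp2l//; lia.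
split=> [|D_gt1].
  rewrite (mean_entangling_power psiP _ rU uU).
  have [a E] := inv_wick_unitary (out_moment_sym psiP mu1 U)
    (fun V uV => out_moment_inv psiP rU uU uV (lU V uV)).
  have {}E : out_moment P psi mu1 U = wick a 0.
    by do 4 (apply/funext => ?); exact: E.
  have := out_moment_trace psiP mu1 rU uU.
  rewrite E wick_trace mul0r addr0 cardI => a1.
  have -> : a = real_complex R (D * (D + 1))^-1.
    have DD : real_complex R (D * (D + 1)) != 0 by rewrite fmorph_eq0 mulf_neq0.
    apply: (mulIf DD); rewrite -rmorphM mulVf ?mulf_neq0// rmorph1 -[RHS]a1.
    by rewrite -rmorphXn -rmorphD; congr (_ * real_complex R _); ring.
  (* The zero coefficient is written as an embedded real, the form [mean_tangle_wick] expects. *)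
  rewrite -[X in wick _ X](rmorph0 (real_complex R)) mean_tangle_wick//= -/C -/D.
  rewrite -[B * C / _]mulrA [f * _]mulrA fB.
  by field; rewrite D0 D1 N0.
have uO t : unitary (O t) by exact: orthogonal_unitary.
rewrite (mean_entangling_power psiP _ rO uO).
have [|a [b E]] := inv_wick (out_moment_sym psiP mu2 O).
  by move=> V oV; apply: (out_moment_inv psiP rO uO (orthogonal_unitary oV) (lO V oV)).
have {}E : out_moment P psi mu2 O = wick a b.
  by do 4 (apply/funext => ?); exact: E.
have := out_moment_trace psiP mu2 rO uO.
have := out_moment_trace_real d_gt0 psiP mu2 rO uO oO.
have -> : \prod_i (2 / ((d i)%:R + 1)) = 2 ^+ n * f :> R.
  by rewrite big_split/= prodr_const card_ord.
rewrite E wick_trace wick_trace_real cardI.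
set X := real_complex R D => e2 e1.
have Dm1 : D - 1 != 0 by rewrite subr_eq0 gt_eqF.
have Dp2 : D + 2 != 0 by rewrite gt_eqF// addr_gt0.
(* The determinant of the two trace equations divided by [D]: eliminating [b] by [X e1 - e2] leaves
   [a K], and eliminating [a] by [(X + 1) e2 - 2 e1] leaves [b K]. At [D = 1] the left sides
   coincide and [K = 0]. *)
pose K := D * (D - 1) * (D + 2).
have K0 : real_complex R K != 0 by rewrite fmorph_eq0 !mulf_neq0.
have -> : a = real_complex R ((D - 2 ^+ n * f) / K).
  apply: (mulIf K0); rewrite -rmorphM divfK -?(fmorph_eq0 (real_complex R))//.
  have -> : a * real_complex R K = X * (a * (X ^+ 2 + X) + b * X)
      - (a * (2 * X) + b * X ^+ 2).
    by rewrite /K !(rmorphM, rmorphB, rmorphD, rmorph1, rmorph_nat)/=; ring.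
  by rewrite e1 e2 mulr1 -rmorphB.
have -> : b = real_complex R ((2 ^+ n * f * (D + 1) - 2) / K).
  apply: (mulIf K0); rewrite -rmorphM divfK -?(fmorph_eq0 (real_complex R))//.
  have -> : b * real_complex R K = (a * (2 * X) + b * X ^+ 2) * (X + 1)
      - 2 * (a * (X ^+ 2 + X) + b * X).
    by rewrite /K !(rmorphM, rmorphB, rmorphD, rmorph1, rmorph_nat)/=; ring.
  by rewrite e1 e2 mulr1 [RHS]rmorphB [in RHS]rmorphM [in RHS]rmorphD/= rmorph1 rmorph_nat.
have f0 : f != 0 by apply/eqP => f0; move: fB; rewrite f0 mul0r => /eqP; rewrite eq_sym oner_eq0.
(* With [B] expressed through [f], the goal is an identity of rational functions. *)
have -> : B = f^-1 by apply: (mulfI f0); rewrite fB divff.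
rewrite mean_tangle_wick//= -/C -/D /K.
by field; rewrite N0 Dm1 Dp2 f0 D0.
Qed.
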